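(* Consider $n$ agents with double-integrator dynamics $\ddot q_i=u_i$, $q_i(0)=q_{i0}$, $\dot q_i(0)=\dot q_{i0}$, $q_i\in\mathbb{R}^m$, $i=1,\dots,n$, interacting over a time-varying undirected graph $\mathcal{G}(t)$ with adjacency weights $a_{ij}(t)\ge 0$. Each agent $i$ measures $\dot q_i$ and, for each neighbor $j$, the biased relative position $z_{ij}=q_i-q_j+b_i$, where $b_i\in\mathbb{R}^m$ is a constant unknown sensor bias. Suppose: (A1) $\mathcal{G}(t)$ is undirected and jointly $(\delta,T)$-connected for some $\delta,T>0$, the same graph is used for measurements and communication, and there is $a_M>0$ with $a_{ij}(t)\le a_M$ for all $i,j$ and all $t\ge 0$; (A2) agents measure their own velocities $\dot q_i$; neighbors measure relative velocities $\dot q_i-\dot q_j$ and the biased relative positions $z_{ij}$; neighbors exchange their relative position measurements $z_{ji}$ and their bias estimates with each other; (A3) the filtered regressors $Y_{F_1},\dots,Y_{F_n}$ (defined in the context) are collectively initially exciting: there exist $\bar T>0$, $\gamma>0$ and some $t_0\ge 0$ with $\int_{t_0}^{t_0+\bar T}\sum_{i=1}^n Y_{F_i}^\top(\tau)Y_{F_i}(\tau)\,d\tau\ge \gamma I_{mn+2}$. Apply the control law (see context) $u_i=k(t)\big(-\dot q_i-\tfrac12\sum_{j\in\mathcal N_i(t)}a_{ij}(t)[z_{ij}+z_{ji}]\big)+w_i$, which in stacked form equals $u=Z_{new}\tilde\theta-\sigma\bar{\mathcal L}(t)s-\lambda\dot q-\lambda\dot{\tilde b}_{new}/2$, together with the bias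 adaptation law given in the context. Then, for sufficiently large $\mu_{IF}>0$, $\lim_{t\to\infty}(q_i-q_j)=0$ for all $i,j\in\{1,\dots,n\}$, $\lim_{t\to\infty}\dot q=0$, and $\lim_{t\to\infty}(b_i-\hat b_i^k)=0$ for all $i,k\in\{1,\dots,n\}$, with exponential convergence beyond the collective initial excitation window (i.e. for $t\ge\bar T$), while all trajectories of the closed-loop system (in the variables $s$ and $\tilde\theta$ defined below) are uniformly bounded.
   Context: Graph notions: $\mathcal N_i(t)$ is the neighbor set of $i$ at time $t$; $a_{ij}(t)>0$ iff $(j,i)$ is an edge, $a_{ii}=0$, $a_{ij}=a_{ji}$. Degree matrix $\mathcal D(t)=\mathrm{diag}(\sum_j a_{1j}(t),\dots,\sum_j a_{nj}(t))$, Laplacian $\mathcal L(t)=\mathcal D(t)-\mathcal A(t)$, signless Laplacian $\mathcal Q(t)=\mathcal D(t)+\mathcal A(t)=[Q_{ij}(t)]$; $\bar{\mathcal L}(t)=\mathcal L(t)\otimes I_m$, $\bar{\mathcal Q}(t)=\mathcal Q(t)\otimes I_m$. The graph is jointly $(\delta,T)$-connected if for all $t\ge 0$ the edges $(j,i)$ with $\int_t^{t+T}a_{ij}(s)\,ds\ge\delta$ form a connected graph on $\{1,\dots,n\}$. Design quantities: $k:\mathbb{R}^+\to\mathbb{R}^+$ is a positive, uniformly bounded function ($k(t)\le k_M$); $\lambda,\sigma,\beta,\mu_F,\mu_{IF}>0$ are constants. Unknown parameter $\theta=[1,\,1,\,b^\top]^\top\in\mathbb{R}^{mn+2}$ with $b=[b_1^\top,\dots,b_n^\top]^\top$.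 Each agent $i$ maintains an estimate $\hat\theta^i=[p^i,\,l^i,\,(\hat b^i)^\top]^\top$, $\hat b^i=[\hat b^i_1,\dots,\hat b^i_n]$ (its estimates of all biases), with arbitrary initial condition; $\tilde\theta^i=\theta-\hat\theta^i$, $\tilde b^i_j=b_j-\hat b^i_j$, $\tilde\theta=[\tilde\theta^1;\dots;\tilde\theta^n]$, $\tilde b_{new}=[\tilde b^1_1;\dots;\tilde b^n_n]$. Define $s_i=\dot q_i+\lambda(q_i+\tilde b_i^i/2)$ and $s=[s_1;\dots;s_n]$. Define $Y_i=\big[\ddot q_i,\; k(t)\dot q_i,\; \tfrac12 k(t)[Q_{i1}(t)I_m,\dots,Q_{in}(t)I_m]\big]\in\mathbb{R}^{m\times(mn+2)}$ and $Z_i=\big[0_{m\times1},\,0_{m\times1},\,-\tfrac12 k(t)[Q_{i1}(t)I_m,\dots,Q_{in}(t)I_m]\big]$, $Z_{new}=\mathrm{diag}(Z_1,\dots,Z_n)$. The auxiliary input is $w_i=k(t)\dot q_i-Z_i\hat\theta^i-\lambda(\dot q_i+\dot{\tilde b}^i_i/2)-\sigma\sum_{j\in\mathcal N_i}a_{ij}(t)(s_i-s_j)$ (implementable since $\dot{\tilde b}^i_i=-\dot{\hat b}^i_i$ and $s_i-s_j=\dot q_i-\dot q_j+\tfrac{\lambda}{2}(z_{ij}-z_{ji}-(\hat b^i_i-\hat b^j_j))$). Filters: $\dot Y_{F_i}=-\beta Y_{F_i}+Y_i$, $\dot w_{F_i}=-\beta w_{F_i}+w_i$, $\dot Y_{IF_i}=Y_{F_i}^\top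 Y_{F_i}$, $\dot w_{IF_i}=Y_{F_i}^\top w_{F_i}$, all with zero initial conditions ($Y_{F_i}$ is computable without $\ddot q_i$ via integration by parts). Adaptation law: $\dot{\hat\theta}^i=\mu_F Y_{F_i}^\top(w_{F_i}-Y_{F_i}\hat\theta^i)+\mu_{IF}(w_{IF_i}-Y_{IF_i}\hat\theta^i)-\sum_{j\in\mathcal N_i}a_{ij}(t)(\hat\theta^i-\hat\theta^j)$, equivalently $\dot{\tilde\theta}=-\mu_F\phi_F\tilde\theta-\mu_{IF}\phi_{IF}\tilde\theta-(\mathcal L(t)\otimes I_{mn+2})\tilde\theta$ with $\phi_F=\mathrm{diag}(Y_{F_1}^\top Y_{F_1},\dots,Y_{F_n}^\top Y_{F_n})$ and $\phi_{IF}=\mathrm{diag}(\int_0^t Y_{F_1}^\top Y_{F_1},\dots,\int_0^t Y_{F_n}^\top Y_{F_n})$. *)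

(* Defs.v *)
From HB Require Import structures.
From mathcomp Require Import all_boot all_order all_algebra.
From mathcomp Require Import all_classical all_reals all_analysis.
Set Implicit Arguments. Unset Strict Implicit. Unset Printing Implicit Defensive.
Import Order.TTheory GRing.Theory Num.Theory.
Import numFieldNormedType.Exports.
Local Open Scope classical_set_scope.
Local Open Scope ring_scope.

Section Defs.
Variable R : realType.
Variables n m : nat.

(* dimension of the unknown parameter theta = [1; 1; b], b in R^{mn} *)
Definition pdim := (m * n).+2.

(* position of component r of the bias b_j inside theta *)
Definition bix (j : 'I_n) (r : 'I_m) : 'I_pdim := inord (2 + j * m + r).

(* the true parameter theta = [1, 1, b_1^T, ..., b_n^T]^T *)
Definition theta_of (b : 'I_n -> 'cV[R]_m) : 'cV[R]_pdim :=
  \col_c (if (c < 2)%N then 1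
          else \sum_(j < n) \sum_(r < m) ((c == bix j r)%:R * b j r 0)).

Definition bpart (th : 'cV[R]_pdim) (j : 'I_n) : 'cV[R]_m :=
  \col_r th (bix j r) 0.

Definition Qsl (a : 'I_n -> 'I_n -> R -> R) (i j : 'I_n) (t : R) : R :=
  (i == j)%:R * (\sum_(l < n) a i l t) + a i j t.

(* the row-block  [Q_i1 I_m, ..., Q_in I_m] placed in columns 2.. of an
   m x pdim matrix, scaled by c *)
Definition Qblock (c : R) (a : 'I_n -> 'I_n -> R -> R) (i : 'I_n) (t : R)
  (r : 'I_m) (col : 'I_pdim) : R :=
  c * \sum_(j < n) (Qsl a i j t * (col == bix j r)%:R).

Definition Ymat (k : R -> R) (a : 'I_n -> 'I_n -> R -> R) (i : 'I_n)
  (acc vel : 'cV[R]_m) (t : R) : 'M[R]_(m, pdim) :=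
  \matrix_(r, col)
    (if col == 0%N :> nat then acc r 0
     else if col == 1%N :> nat then k t * vel r 0
     else Qblock (k t / 2) a i t r col).

Definition Zmat (k : R -> R) (a : 'I_n -> 'I_n -> R -> R) (i : 'I_n)
  (t : R) : 'M[R]_(m, pdim) :=
  \matrix_(r, col)
    (if (col < 2)%N then 0 else Qblock (- (k t / 2)) a i t r col).

Definition mint (p1 p2 : nat) (f : R -> 'M[R]_(p1, p2)) (s t : R)
  : 'M[R]_(p1, p2) :=
  \matrix_(i, j) (\int[lebesgue_measure]_(x in `[s, t]) f x i j).

Definition mintegrable (p1 p2 : nat) (f : R -> 'M[R]_(p1, p2)) (s t : R)
  : Prop :=
  forall i j, lebesgue_measure.-integrable `[s, t] (fun x => (f x i j)%:E).

Definition psd_ge (p : nat) (M N : 'M[R]_p) : Prop :=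
  forall v : 'cV[R]_p, 0 <= (v^T *m (M - N) *m v) 0 0.

Definition jointly_connected (a : 'I_n -> 'I_n -> R -> R) (delta T : R)
  : Prop :=
  forall t : R, 0 <= t -> forall i j : 'I_n,
    connect (fun x y : 'I_n =>
      delta <= \int[lebesgue_measure]_(s in `[t, t + T]) a x y s) i j.


Section ClosedLoop.
Variables (lam sig beta muF muIF : R) (k : R -> R)
          (a : 'I_n -> 'I_n -> R -> R) (b : 'I_n -> 'cV[R]_m).
Variables (q dq : 'I_n -> R -> 'cV[R]_m) (th : 'I_n -> R -> 'cV[R]_pdim)
          (YF : 'I_n -> R -> 'M[R]_(m, pdim)) (wF : 'I_n -> R -> 'cV[R]_m)
          (YIF : 'I_n -> R -> 'M[R]_pdim) (wIF : 'I_n -> R -> 'cV[R]_pdim).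

Definition btil (i j : 'I_n) (t : R) : 'cV[R]_m := b j - bpart (th i t) j.

Definition thtil (i : 'I_n) (t : R) : 'cV[R]_pdim := theta_of b - th i t.

Definition sv (i : 'I_n) (t : R) : 'cV[R]_m :=
  dq i t + lam *: (q i t + 2^-1 *: btil i i t).

Definition zmeas (i j : 'I_n) (t : R) : 'cV[R]_m := q i t - q j t + b i.

Definition adapt (i : 'I_n) (t : R) : 'cV[R]_pdim :=
  muF *: ((YF i t)^T *m (wF i t - YF i t *m th i t))
  + muIF *: (wIF i t - YIF i t *m th i t)
  - \sum_(j < n) a i j t *: (th i t - th j t).

(* d/dt tilde b^i_i = - d/dt hat b^i_i *)
Definition dbtil_ii (i : 'I_n) (t : R) : 'cV[R]_m := - bpart (adapt i t) i.

Definition waux (i : 'I_n) (t : R) : 'cV[R]_m :=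
  k t *: dq i t - Zmat k a i t *m th i t
  - lam *: (dq i t + 2^-1 *: dbtil_ii i t)
  - sig *: \sum_(j < n) a i j t *: (sv i t - sv j t).

Definition uctl (i : 'I_n) (t : R) : 'cV[R]_m :=
  k t *: (- dq i t
          - 2^-1 *: \sum_(j < n) a i j t *: (zmeas i j t + zmeas j i t))
  + waux i t.

(* Y_i, with ddq_i = u_i (closed loop) *)
Definition Yreg (i : 'I_n) (t : R) : 'M[R]_(m, pdim) :=
  Ymat k a i (uctl i t) (dq i t) t.

(* x is a (Caratheodory) solution of  dx/dt = f,  on [0, +oo):
   f is integrable on every [0, t] and x t = x 0 + int_0^t f *)
Definition solves (p1 p2 : nat) (x f : R -> 'M[R]_(p1, p2)) : Prop :=
  forall t, 0 <= t -> mintegrable f 0 t /\ x t = x 0 + mint f 0 t.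

Definition closed_loop : Prop :=
  forall i : 'I_n,
  solves (q i) (dq i) /\
  solves (dq i) (uctl i) /\
  solves (th i) (adapt i) /\
  (solves (YF i) (fun t => - beta *: YF i t + Yreg i t) /\ YF i 0 = 0) /\
  (solves (wF i) (fun t => - beta *: wF i t + waux i t) /\ wF i 0 = 0) /\
  (solves (YIF i) (fun t => (YF i t)^T *m YF i t) /\ YIF i 0 = 0) /\
  (solves (wIF i) (fun t => (YF i t)^T *m wF i t) /\ wIF i 0 = 0).

End ClosedLoop.

End Defs.

(* Main.v *)
(* Writing x_i for the parameter error of agent i, the identities wF = YF theta and wIF = YIF theta
   turn the adaptation law into the linear system
     x_i' = - muF YF_i^T YF_i x_i - muIF YIF_i x_i - sum_j a_ij (x_i - x_j),
   whose energy V = sum_i |x_i|^2 is nonincreasing.  The Gramians YIF_i are nondecreasing but may be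
   unbounded, so the speed of x_i is not controlled by the dissipation.  It is after applying the
   limit E_i of the resolvents (1 + YIF_i)^-1: over a window of length T the vector E_i x_i moves by
   O(sqrt D), where D is the decrease of V, while |x_i - E_i x_i|^2 is at most
   2 x_i^T YIF_i x_i + e |x_i|^2 eventually, for every e > 0.  On such a window the x_i are therefore
   close to constants, which agree by joint connectivity and vanish by the collective excitation;
   this gives T V(t + T) <= C (D + e V(t)), hence exponential decay.

   Then s_i' = - sig sum_j a_ij (s_i - s_j) + Z_i x_i is a consensus system with an exponentially
   vanishing perturbation, and s_i - lam q_i satisfies p' = - lam p + (exponentially small terms),
   which gives the velocities and the relative positions. *)

Require Import Defs.
From HB Require Import structures.
From mathcomp Require Import all_boot all_order all_algebra.
From mathcomp Require Import all_classical all_reals all_analysis.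
From mathcomp Require Import ring lra.
Import Order.TTheory GRing.Theory Num.Theory.
Import numFieldNormedType.Exports.
Set Implicit Arguments. Unset Strict Implicit. Unset Printing Implicit Defensive.
Local Open Scope classical_set_scope.
Local Open Scope ring_scope.

(** * Absolutely continuous functions *)

(** A large Gramian acts in two opposite ways: it damps the error, but through [muIF * W x] it also
    makes the error move fast. The operators [E_i] separate the two effects. Every vector [E_i^T v]
    has Gramian energy bounded for all time, so along it the movement is paid for by the
    dissipation; what [E_i] removes from [x_i] is controlled by [x_i^T W_i x_i], which is itself
    dissipated. The price is the error [e], due to replacing resolvents by their limit. Since [C] is
    fixed before [e] and only the starting time depends on [e], this error can be made small enough
    to be absorbed into the contraction. The weights are merely measurable, so rates are compared
    only after integration. *)

Section AbsolutelyContinuous.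
Variable R : realType.
Local Notation mu := (@lebesgue_measure R).
Implicit Types (x y f g D F G : R -> R) (s t : R).

(** Caratheodory form of [x' = f] on the half line, which is the scalar version of [solves]. *)
Definition ac x f := forall t, 0 <= t ->
  mu.-integrable `[0, t] (EFin \o f) /\ x t = x 0 + \int[mu]_(r in `[0, t]) f r.

Lemma ac_integrable x f s t : ac x f -> 0 <= s -> mu.-integrable `[s, t] (EFin \o f).
Proof.
move=> xf s0; have [st|ts] := leP s t; last first.
  rewrite set_itv_ge ?bnd_simp -?ltNge//; exact: integrable_set0.
have [+ _] := xf t (le_trans s0 st); apply: integrableS => //.
by apply: subset_itvr; rewrite bnd_simp.
Qed.

Lemma ac_diff x f s t : ac x f -> 0 <= s -> s <= t ->
  x t - x s = \int[mu]_(r in `[s, t]) f r.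
Proof.
move=> xf s0 st; have t0 := le_trans s0 st.
have [it ->] := xf _ t0; have [is_ ->] := xf _ s0.
rewrite opprD addrACA subrr add0r (Rintegral_itvB it) ?bnd_simp//.
by rewrite Rintegral_itv_obnd_cbnd//; apply: integrableS it => //;
  apply: subset_itvr; rewrite bnd_simp.
Qed.

Lemma ac_continuous x f t : ac x f -> {within `[0, t], continuous x}.
Proof.
move=> xf; have [t0|t0] := leP 0 t; last first.
  rewrite set_itv_ge ?bnd_simp -?ltNge//; exact: continuous_subspace0.
have c := parameterized_integral_continuous t0 (xf t t0).1.
have c2 : {within `[0, t], continuous (cst (x 0) \+ parameterized_integral mu 0 ^~ f)}.
  move=> r; apply: cvgD; [exact: cvg_cst|exact: c].
apply: subspace_eq_continuous c2 => r /set_mem/=; rewrite in_itv/= => /andP[r0 _].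
by exact: esym (xf _ r0).2.
Qed.

Lemma ac_measurable x f t : ac x f -> measurable_fun `[0, t] x.
Proof.
move=> xf; apply: measurable_realfun.subspace_continuous_measurable_fun => //.
exact: ac_continuous xf.
Qed.

Lemma ac_bounded x f t : ac x f -> [bounded x r | r in `[0, t]].
Proof.
move=> xf; have [M [mr Mx]] := compact_bounded (continuous_compact (@ac_continuous x f t xf)
  (@segment_compact _ 0 t)).
by exists M; split => // y My r rt; apply: Mx => //; exists r.
Qed.

Lemma ac_le x f y g s t : ac x f -> ac y g -> 0 <= s -> s <= t ->
  (forall r, s <= r -> r <= t -> f r <= g r) -> x t - x s <= y t - y s.
Proof.
move=> xf yg s0 st fg; rewrite (ac_diff xf)// (ac_diff yg)//.
apply: le_Rintegral => //; [exact: ac_integrable xf s0|exact: ac_integrable yg s0|].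
by move=> r /=; rewrite in_itv/= => /andP[]; apply: fg.
Qed.

Lemma ac_norm_le x f y g s t : ac x f -> ac y g -> 0 <= s -> s <= t ->
  (forall r, s <= r -> r <= t -> `|f r| <= g r) -> `|x t - x s| <= y t - y s.
Proof.
move=> xf yg s0 st fg; rewrite (ac_diff xf)// (ac_diff yg)//.
have ixf := @ac_integrable x f s t xf s0.
apply: le_trans (le_normr_Rintegral _ ixf) _ => //.
apply: le_Rintegral => //; [exact: integrable_norm|exact: ac_integrable yg s0|].
by move=> r /=; rewrite in_itv/= => /andP[]; apply: fg.
Qed.

Lemma ac_eq x y f g : (forall t, 0 <= t -> x t = y t) -> (forall t, 0 <= t -> f t = g t) ->
  ac x f -> ac y g.
Proof.
move=> xy fg xf t t0; have [it xt] := xf t t0.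
have e : {in `[0, t], f =1 g}.
  by move=> r; rewrite in_itv/= => /andP[r0 _]; apply: fg.
split.
  apply: eq_integrable it => // r; rewrite inE => /e; rewrite /= => ->//.
rewrite -!xy// xt; congr (_ + _); apply: eq_Rintegral => r; rewrite inE; exact: e.
Qed.

Lemma ac_cst (c : R) : ac (fun=> c) (fun=> 0).
Proof.
move=> t t0; split; last by rewrite Rintegral_cst// mul0r addr0.
exact: integrable0.
Qed.

Lemma acD x y f g : ac x f -> ac y g -> ac (fun t => x t + y t) (fun t => f t + g t).
Proof.
move=> xf yg t t0; have [i1 e1] := xf t t0; have [i2 e2] := yg t t0; split.
  exact: (integrableD _ i1 i2).
by rewrite RintegralD// e1 e2 addrACA.
Qed.

Lemma acZ (c : R) x f : ac x f -> ac (fun t => c * x t) (fun t => c * f t).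
Proof.
move=> xf t t0; have [i1 e1] := xf t t0; split; first exact: (integrableZl _ _ i1).
by rewrite RintegralZl// e1 mulrDr.
Qed.

Lemma acN x f : ac x f -> ac (fun t => - x t) (fun t => - f t).
Proof.
by move=> /(acZ (-1)); apply: ac_eq => t _; rewrite mulN1r.
Qed.

Lemma acB x y f g : ac x f -> ac y g -> ac (fun t => x t - y t) (fun t => f t - g t).
Proof. by move=> xf yg; apply: acD xf (acN yg). Qed.

Lemma ac_sum (I : Type) (r : seq I) (P : pred I) (x f : I -> R -> R) :
  (forall i, ac (x i) (f i)) ->
  ac (fun t => \sum_(i <- r | P i) x i t) (fun t => \sum_(i <- r | P i) f i t).
Proof.
move=> xf; elim: r => [|i r IH].
  by apply: ac_eq (ac_cst 0) => t _; rewrite big_nil.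
have [Pi|Pi] := boolP (P i).
  by apply: ac_eq (acD (xf i) IH) => t _; rewrite big_cons Pi.
by apply: ac_eq IH => t _; rewrite big_cons (negbTE Pi).
Qed.

Lemma ac_primitive f : (forall t, 0 <= t -> mu.-integrable `[0, t] (EFin \o f)) ->
  ac (fun t => \int[mu]_(r in `[0, t]) f r) f.
Proof.
move=> fi t t0; split; first exact: fi.
by rewrite set_itv1 Rintegral_set1 add0r.
Qed.

Lemma integrableM_cont x f g t : ac x f -> mu.-integrable `[0, t] (EFin \o g) ->
  mu.-integrable `[0, t] (EFin \o (fun r => x r * g r)).
Proof.
move=> xf gi.
have : mu.-integrable `[0, t] ((EFin \o x) \* (EFin \o g))%E.
  by apply: integrableMr => //; [exact: ac_measurable xf|exact: ac_bounded xf].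
by apply: eq_integrable => // r _ /=; rewrite EFinM.
Qed.

(* Bisecting [s, t] at the midpoint of the values of F halves the bound on D t - D s. *)
Lemma small_increments_const D F G (M : R) :
  {within `[0, M], continuous F} ->
  (forall s t, 0 <= s -> s <= t -> t <= M -> F s <= F t) ->
  (forall s t, 0 <= s -> s <= t -> t <= M -> `|D t - D s| <= (F t - F s) * (G t - G s)) ->
  0 <= M -> D M = D 0.
Proof.
move=> cF ndF DFG M0.
have H (k : nat) s t : 0 <= s -> s <= t -> t <= M ->
    `|D t - D s| * 2 ^+ k <= (F t - F s) * (G t - G s).
  elim: k s t => [|k IH] s t s0 st tM; first by rewrite mulr1 DFG.
  have cF' : {within `[s, t], continuous F}.
    by apply: continuous_subspaceW cF; apply: subset_itv; rewrite bnd_simp.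
  have Fst := ndF _ _ s0 st tM.
  have [] := @IVT R F s t ((F s + F t) / 2) st cF'.
    by rewrite /Order.min /Order.max; case: ltgtP Fst => // ? _; apply/andP; split; lra.
  move=> c; rewrite in_itv/= => /andP[sc ct] Fc.
  have h1 := IH _ _ s0 sc (le_trans ct tM).
  have h2 := IH _ _ (le_trans s0 sc) ct tM.
  have h3 : `|D t - D s| <= `|D t - D c| + `|D c - D s|.
    by apply: le_trans (ler_normD _ _); rewrite addrA subrK.
  have k0 : 0 <= 2 ^+ k :> R by rewrite exprn_ge0.
  have := ler_wpM2r k0 h3; rewrite exprS; rewrite Fc in h1 h2; nra.
apply/eqP; rewrite -subr_eq0 -normr_le0 leNgt; apply/negP => D0.
set e := `|_| in D0; set C := (F M - F 0) * (G M - G 0).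
have := H _ _ _ (lexx 0) M0 (lexx _); rewrite -/e -/C => {}H.
have [N] : exists N : nat, C / e < N%:R.
  by exists (Num.truncn `|C / e|).+1; apply: le_lt_trans (ler_norm _) _; exact: truncnS_gt.
rewrite ltr_pdivrMr// ltNge => /negP; apply.
apply: le_trans (H N); rewrite mulrC ler_pM2l// -natrX ler_nat ltnW// ltn_expl//.
Qed.

(** The product rule without differentiating: the defect [D] between [x y] and the integral of the
    candidate rate has increments of second order, so it is constant by [small_increments_const]. *)
Lemma acM x y f g : ac x f -> ac y g ->
  ac (fun t => x t * y t) (fun t => f t * y t + x t * g t).
Proof.
move=> xf yg.
have ifx t : 0 <= t -> mu.-integrable `[0, t] (EFin \o f) by move=> /xf[].
have ify t : 0 <= t -> mu.-integrable `[0, t] (EFin \o g) by move=> /yg[].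
have i1 t : 0 <= t -> mu.-integrable `[0, t] (EFin \o (fun t => f t * y t + x t * g t)).
  move=> t0; have h1 := integrableM_cont xf (ify _ t0).
  have h2 := integrableM_cont yg (ifx _ t0).
  have := integrableD _ h2 h1 => /(_ (measurable_itv _)).
  by apply: eq_integrable => // r _; rewrite /= -EFinD mulrC.
pose F := fun t => \int[mu]_(r in `[0, t]) `|f r|.
(* The factor 2 pays for two error terms, each at most the product of the integrals of [|f|] and
   [|g|] over the interval. *)
pose G := fun t => 2 * \int[mu]_(r in `[0, t]) `|g r|.
have aF : ac F (fun r => `|f r|).
  by apply: ac_primitive => t t0; exact: (integrable_norm (ifx _ t0)).
have aG : ac G (fun r => 2 * `|g r|).
  by apply: acZ; apply: ac_primitive => t t0; exact: (integrable_norm (ify _ t0)).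
have aP := ac_primitive i1.
move=> t t0; split; first exact: i1.
pose D t := x t * y t - \int[mu]_(r in `[0, t]) (f r * y r + x r * g r).
suff : D t = D 0.
  rewrite /D set_itv1 Rintegral_set1 subr0 => /eqP; rewrite subr_eq => /eqP->.
  by [].
apply: (@small_increments_const D F G t) => //; first exact: ac_continuous aF.
  move=> u v u0 uv vt; rewrite -subr_ge0 (ac_diff aF)//.
  by apply: Rintegral_ge0.
move=> u v u0 uv vt.
have inc r : u <= r -> r <= v -> `|x r - x u| <= F v - F u /\ `|y v - y r| <= (G v - G u) / 2.
  move=> ur rv; have r0 := le_trans u0 ur.
  have hF w1 w2 : 0 <= w1 -> w1 <= w2 -> F w1 <= F w2.
    by move=> w0 w12; rewrite -subr_ge0 (ac_diff aF)//; apply: Rintegral_ge0.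
  have hG w1 w2 : 0 <= w1 -> w1 <= w2 -> G w1 <= G w2.
    move=> w0 w12; rewrite -subr_ge0 (ac_diff aG)//; apply: Rintegral_ge0 => z _.
    by rewrite mulr_ge0.
  split.
    apply: le_trans (ac_norm_le xf aF u0 ur _) _ => //.
    by rewrite lerD2r hF.
  have h3 : `|y v - y r| <= 2^-1 * G v - 2^-1 * G r.
    by apply: ac_norm_le yg (acZ 2^-1 aG) r0 rv _ => w _ _; rewrite mulrA mulVf ?mul1r.
  by apply: le_trans h3 _; have := hG _ _ u0 ur; lra.
pose K r := y v * x r + x u * y r - \int[mu]_(w in `[0, r]) (f w * y w + x w * g w).
have aK : ac K (fun r => y v * f r + x u * g r - (f r * y r + x r * g r)).
  exact: acB (acD (acZ (y v) xf) (acZ (x u) yg)) aP.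
have aB := acD (acZ ((G v - G u) / 2) aF) (acZ ((F v - F u) / 2) aG).
have -> : D v - D u = K v - K u by rewrite /D /K; ring.
have -> : (F v - F u) * (G v - G u) = (G v - G u) / 2 * F v + (F v - F u) / 2 * G v -
  ((G v - G u) / 2 * F u + (F v - F u) / 2 * G u) by field.
apply: ac_norm_le aK aB u0 uv _ => r ur rv.
have [h1 h2] := inc r ur rv.
have -> : y v * f r + x u * g r - (f r * y r + x r * g r)
   = f r * (y v - y r) - (x r - x u) * g r by ring.
apply: le_trans (ler_normB _ _) _; rewrite !normrM.
have -> : (F v - F u) / 2 * (2 * `|g r|) = (F v - F u) * `|g r| by field.
by apply: lerD; [rewrite [leLHS]mulrC|]; apply: ler_wpM2r.
Qed.

End AbsolutelyContinuous.

(** * Exponential decay *)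

Section ExponentialDecay.
Variable R : realType.
Implicit Types (k rho c : R).

Lemma ac_expR k : ac (fun t : R => expR (k * t)) (fun t => k * expR (k * t)).
Proof.
have dF (t : R) : is_derive t 1 (fun t : R => expR (k * t)) (k * expR (k * t)).
  have h : is_derive t (1:R) ( *%R k : R -> R) k.
    have := @is_deriveZ R R R id k t 1 1 (is_derive_id _ _).
    by rewrite /GRing.scale /= mulr1.
  have := @is_derive1_comp R (expR) ( *%R k) t (expR (k * t)) k (is_derive_expR _) h.
  by rewrite mulrC.
have cF : continuous (fun t : R => expR (k * t)).
  by move=> t; apply: differentiable_continuous; apply/derivable1_diffP; apply: ex_derive.
have cf : continuous (fun t : R => k * expR (k * t)).
  by move=> t; apply: cvgM; [exact: cvg_cst|exact: cF].
move=> t; rewrite le_eqVlt => /predU1P[<-|t0].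
  rewrite set_itv1 Rintegral_set1 addr0; split => //.
  have := (@continuous_compact_integrable R (fun t : R => k * expR (k * t)) [set 0]).
  by apply; [exact: compact_set1|exact: continuous_subspaceT].
split.
  have := (@continuous_compact_integrable R (fun t : R => k * expR (k * t)) `[0, t]).
  by apply; [exact: segment_compact|exact: continuous_subspaceT].
have := @continuous_FTC2 R (fun t : R => k * expR (k * t)) (fun t : R => expR (k * t)) 0 t t0
  (continuous_subspaceT cf) _ _.
rewrite /Rintegral => ->.
- by rewrite -EFinB /=; ring.
- split.
  + by move=> x _; apply: ex_derive.
  + by apply: cvg_at_right_filter; apply: cF.
  + by apply: cvg_at_left_filter; apply: cF.
- by move=> x _; rewrite derive1E; apply: derive_val.
Qed.

(** The integrating factor [expR (k * t)] leaves a rate bounded by [c * expR ((k - rho) * t)], whose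
    primitive carries the constant [c / (k - rho)]. *)
Lemma stable_filter_decay (p f : R -> R) k rho c : ac p f -> rho < k ->
  (forall t, 0 <= t -> `|f t + k * p t| <= c * expR (- rho * t)) ->
  forall t, 0 <= t -> `|p t| <= (`|p 0| + c / (k - rho)) * expR (- rho * t).
Proof.
move=> pf rk fc t t0.
have kr : 0 < k - rho by rewrite subr_gt0.
have c0 : 0 <= c.
  by have := le_trans (normr_ge0 _) (fc 0 (lexx _)); rewrite mulr0 expR0 mulr1.
have aE := acM (ac_expR k) pf.
have aG := acZ (c / (k - rho)) (ac_expR (k - rho)).
have := ac_norm_le aE aG (lexx 0) t0; rewrite !mulr0 expR0 mul1r mulr1 => h.
have {}h : `|expR (k * t) * p t - p 0| <=
    c / (k - rho) * expR ((k - rho) * t) - c / (k - rho).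
  apply: h => r r0 _.
  have -> : k * expR (k * r) * p r + expR (k * r) * f r = expR (k * r) * (f r + k * p r) by ring.
  rewrite normrM (ger0_norm (expR_ge0 _)).
  apply: le_trans (ler_wpM2l (expR_ge0 _) (fc r r0)) _.
  rewrite mulrCA -expRD mulrA divfK ?gt_eqF//.
  by rewrite mulrBl mulNr.
have d0 : 0 <= c / (k - rho) by rewrite divr_ge0// ltW.
have h2 : `|expR (k * t) * p t| <= `|p 0| + c / (k - rho) * expR ((k - rho) * t).
  have := ler_normD (expR (k * t) * p t - p 0) (p 0); rewrite subrK; lra.
have -> : `|p t| = expR (- k * t) * `|expR (k * t) * p t|.
  rewrite normrM (ger0_norm (expR_ge0 _)) mulrA -expRD mulNr addNr expR0 mul1r//.
apply: le_trans (ler_wpM2l (expR_ge0 _) h2) _.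
rewrite mulrDr [leRHS]mulrDl lerD//.
  rewrite mulrC ler_wpM2l// ler_expR; nra.
rewrite mulrCA -expRD ler_wpM2l// ler_expR; lra.
Qed.

Lemma linear_ode_zero (p f : R -> R) k : 0 < k -> ac p f -> p 0 = 0 ->
  (forall t, 0 <= t -> f t = - k * p t) -> forall t, 0 <= t -> p t = 0.
Proof.
move=> k0 pf p0 fE t t0; apply/eqP; rewrite -normr_le0.
have /= := @stable_filter_decay p f k (k / 2) 0 pf _ _ t t0.
rewrite p0 normr0 mul0r addr0 mul0r; apply; first lra.
by move=> r r0; rewrite fE// mulNr addNr normr0 mul0r.
Qed.

Lemma window_contraction (Phi : R -> R) (kap t1 T B : R) : 0 < T -> 0 <= t1 -> kap < 1 ->
  (forall t, 0 <= t -> 0 <= Phi t) ->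
  (forall t, t1 <= t -> Phi (t + T) <= kap * Phi t) ->
  (forall t, 0 <= t -> t <= t1 + T -> Phi t <= B) ->
  exists c rho : R, [/\ 0 <= c, 0 < rho & forall t, 0 <= t -> Phi t <= c * expR (- rho * t)].
Proof.
move=> T0 t10 k1 P0 Pk PB.
(* Raising the factor to at least 1/2 keeps [ln k] meaningful; [rho] is then such that a shift by
   [T] costs exactly the factor [k]. *)
pose k := Num.max kap 2^-1; have k2 : 0 < k by rewrite lt_max; apply/orP; right; lra.
have k3 : k < 1 by rewrite gt_max k1; lra.
have k4 : kap <= k by rewrite le_max lexx.
have B0 : 0 <= B by apply: le_trans (P0 0 (lexx _)) (PB _ _ _) => //; lra.
pose rho := - ln k / T.
have r0 : 0 < rho by rewrite divr_gt0// oppr_gt0 ln_lt0// k2.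
have rT : expR (- rho * T) = k by rewrite mulNr divfK ?gt_eqF// opprK lnK.
exists (B * expR (rho * (t1 + T))), rho; split => //; first by rewrite mulr_ge0// expR_ge0.
have H (n : nat) t : 0 <= t -> t <= t1 + T + T *+ n ->
    Phi t <= B * expR (rho * (t1 + T)) * expR (- rho * t).
  elim: n t => [|n IH] t t0.
    rewrite mulr0n addr0 => tT; apply: le_trans (PB _ t0 tT) _.
    by rewrite -mulrA -expRD ler_peMr// -expR0 ler_expR; nra.
  rewrite mulrS => tT; have [h|h] := leP t (t1 + T).
    by apply: IH => //; apply: le_trans h _; rewrite lerDl mulrn_wge0// ltW.
  have {}IH := IH (t - T) _ _.
  have := Pk (t - T); rewrite subrK => /(_ _)/le_trans -> //; first lra.
  apply: (@le_trans _ _ (k * Phi (t - T))); first by rewrite ler_wpM2r// P0//; lra.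
  apply: le_trans (ler_wpM2l (ltW k2) (IH _ _)) _; [lra|lra|].
  rewrite -rT mulrCA -expRD.
  by have -> : - rho * T + - rho * (t - T) = - rho * t by ring.
move=> t t0.
apply: (H (Num.truncn (t / T)).+1) => //.
have : t / T < (Num.truncn (t / T)).+1%:R by exact: truncnS_gt.
by rewrite ltr_pdivrMr// mulr_natl; lra.
Qed.

End ExponentialDecay.

(** * Quadratic forms and limits of resolvents *)

Lemma eq_imply_le (R : numDomainType) (x y : R) : x = y -> x <= y.
Proof. by move->. Qed.

Section QuadraticForms.
Variable R : realType.

Definition dotv p (u v : 'cV[R]_p) : R := (u^T *m v) 0 0.
Definition nsq p (v : 'cV[R]_p) : R := dotv v v.
Definition qf p (W : 'M[R]_p) (v : 'cV[R]_p) : R := dotv v (W *m v).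

Lemma dotvE p (u v : 'cV[R]_p) : dotv u v = \sum_c u c 0 * v c 0.
Proof. by rewrite /dotv mxE; apply: eq_bigr => c _; rewrite mxE. Qed.

Lemma dotvC p (u v : 'cV[R]_p) : dotv u v = dotv v u.
Proof. by rewrite !dotvE; apply: eq_bigr => c _; rewrite mulrC. Qed.

Lemma dotvDr p (u v w : 'cV[R]_p) : dotv u (v + w) = dotv u v + dotv u w.
Proof. by rewrite /dotv mulmxDr mxE. Qed.

Lemma dotvDl p (u v w : 'cV[R]_p) : dotv (v + w) u = dotv v u + dotv w u.
Proof. by rewrite dotvC dotvDr !(dotvC u). Qed.

Lemma dotvZr p (u v : 'cV[R]_p) (k : R) : dotv u (k *: v) = k * dotv u v.
Proof. by rewrite /dotv -scalemxAr mxE. Qed.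

Lemma dotvZl p (u v : 'cV[R]_p) (k : R) : dotv (k *: u) v = k * dotv u v.
Proof. by rewrite dotvC dotvZr dotvC. Qed.

Lemma dotvNr p (u v : 'cV[R]_p) : dotv u (- v) = - dotv u v.
Proof. by rewrite -scaleN1r dotvZr mulN1r. Qed.

Lemma dotvNl p (u v : 'cV[R]_p) : dotv (- u) v = - dotv u v.
Proof. by rewrite dotvC dotvNr dotvC. Qed.

Lemma dotv0r p (u : 'cV[R]_p) : dotv u 0 = 0.
Proof. by rewrite /dotv mulmx0 mxE. Qed.

Lemma dotv_sumr p (I : Type) (r : seq I) (P : pred I) (u : 'cV[R]_p) (v : I -> 'cV[R]_p) :
  dotv u (\sum_(i <- r | P i) v i) = \sum_(i <- r | P i) dotv u (v i).
Proof. by rewrite /dotv mulmx_sumr summxE. Qed.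

Lemma dotv_mul p q (A : 'M[R]_(p, q)) u v : dotv u (A *m v) = dotv (A^T *m u) v.
Proof. by rewrite /dotv trmx_mul trmxK mulmxA. Qed.

Lemma nsq_ge0 p (v : 'cV[R]_p) : 0 <= nsq v.
Proof. by rewrite /nsq dotvE sumr_ge0// => c _; rewrite -expr2 sqr_ge0. Qed.

Lemma nsq_eq0 p (v : 'cV[R]_p) : nsq v <= 0 -> v = 0.
Proof.
move=> v0; have /eqP : nsq v = 0 by apply/eqP; rewrite eq_le v0 nsq_ge0.
rewrite /nsq dotvE psumr_eq0 => [/allP h|c _]; last by rewrite -expr2 sqr_ge0.
apply/matrixP => i j; rewrite ord1 mxE; have := h i (mem_index_enum _).
by rewrite mulf_eq0 orbb => /eqP.
Qed.

Lemma sqr_entry_le_nsq p (v : 'cV[R]_p) c : (v c 0) ^+ 2 <= nsq v.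
Proof.
rewrite /nsq dotvE (bigD1 c)//= expr2 lerDl sumr_ge0// => i _.
by rewrite -expr2 sqr_ge0.
Qed.

Lemma nsqE p (v : 'cV[R]_p) : nsq v = \sum_c (v c 0) ^+ 2.
Proof. by rewrite /nsq dotvE; apply: eq_bigr => c _; rewrite expr2. Qed.

Lemma nsqN p (v : 'cV[R]_p) : nsq (- v) = nsq v.
Proof. by rewrite /nsq dotvNl dotvNr opprK. Qed.

Lemma nsqZ p (v : 'cV[R]_p) (k : R) : nsq (k *: v) = k ^+ 2 * nsq v.
Proof. by rewrite /nsq dotvZl dotvZr mulrA. Qed.

Lemma nsqD p (u v : 'cV[R]_p) : nsq (u + v) = nsq u + 2 * dotv u v + nsq v.
Proof. rewrite /nsq dotvDl !dotvDr (dotvC v u); ring. Qed.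

Lemma nsqD_le p (u v : 'cV[R]_p) : nsq (u + v) <= 2 * nsq u + 2 * nsq v.
Proof. have := nsq_ge0 (u - v); rewrite !nsqD nsqN dotvNr; lra. Qed.

Lemma nsqB_le p (u v : 'cV[R]_p) : nsq (u - v) <= 2 * nsq u + 2 * nsq v.
Proof. by rewrite -(nsqN v) nsqD_le. Qed.

Lemma young p (u v : 'cV[R]_p) (k : R) : 0 < k -> `|dotv u v| <= k / 2 * nsq u + nsq v / (2 * k).
Proof.
move=> k0.
have h1 := nsq_ge0 (k *: u + v); have h2 := nsq_ge0 (k *: u - v).
rewrite !nsqD nsqN dotvNr nsqZ dotvZl in h1 h2.
have -> : k / 2 * nsq u + nsq v / (2 * k) = (k ^+ 2 * nsq u + nsq v) / (2 * k) by field; lra.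
by rewrite ler_norml lerNl !ler_pdivlMr ?mulr_gt0//; apply/andP; split; lra.
Qed.

Lemma qfD_le p (W : 'M[R]_p) u v : (forall v, 0 <= qf W v) ->
  qf W (u + v) <= 2 * qf W u + 2 * qf W v.
Proof.
move=> /(_ (u - v)); rewrite /qf !mulmxDr !dotvDl !dotvDr !mulmxN !dotvNl !dotvNr; lra.
Qed.

(** Young's inequality in the seminorm of [W]: the Gramian term is estimated through [qf W u] alone
    and not through the size of [W]. *)
Lemma qf_young p (W : 'M[R]_p) u v (k : R) : W^T = W -> (forall v, 0 <= qf W v) -> 0 < k ->
  `|dotv u (W *m v)| <= k / 2 * qf W u + qf W v / (2 * k).
Proof.
move=> sW pW k0; have e : dotv v (W *m u) = dotv u (W *m v) by rewrite dotv_mul sW dotvC.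
clear sW; have h1 := pW (k *: u + v); have h2 := pW (k *: u - v).
have -> : k / 2 * qf W u + qf W v / (2 * k) = (k ^+ 2 * qf W u + qf W v) / (2 * k) by field; lra.
rewrite /qf !mulmxDr !dotvDl !dotvDr !mulmxN -!scalemxAr !dotvNl !dotvNr !dotvZl !dotvZr e in h1 h2.
by rewrite ler_norml lerNl !ler_pdivlMr ?mulr_gt0// /qf; apply/andP; split; lra.
Qed.

Lemma qf_bound p (W : 'M[R]_p) : exists2 L : R, 0 <= L & forall v, qf W v <= L * nsq v.
Proof.
exists (\sum_i \sum_j `|W i j|); first by do 2 rewrite sumr_ge0 => // *.
move=> v; rewrite /qf dotvE mulr_suml ler_sum// => i _.
rewrite mxE mulr_sumr mulr_suml ler_sum// => j _.
apply: le_trans (ler_norm _) _; rewrite !normrM.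
have hi : `|v i 0| ^+ 2 <= nsq v by rewrite real_normK ?num_real// sqr_entry_le_nsq.
have hj : `|v j 0| ^+ 2 <= nsq v by rewrite real_normK ?num_real// sqr_entry_le_nsq.
rewrite mulrCA ler_wpM2l//.
have := sqr_ge0 (`|v i 0| - `|v j 0|); nra.
Qed.

Lemma nsq_mul_small p (M : 'M[R]_p) (e : R) v : (forall i j, `|M i j| <= e) ->
  nsq (M *m v) <= (p%:R * p%:R * e ^+ 2) * nsq v.
Proof.
move=> Me; rewrite [leLHS]nsqE.
have h (i : 'I_p) : ((M *m v) i 0) ^+ 2 <= p%:R * e ^+ 2 * nsq v.
  have e0 : 0 <= e by apply: le_trans (Me i i).
  rewrite mxE; set S := \sum_j _.
  have : nsq (\col_j (M i j)) <= p%:R * e ^+ 2.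
    rewrite nsqE; apply: (@le_trans _ _ (\sum_(j < p) e ^+ 2)).
      apply: ler_sum => j _; rewrite mxE -real_normK ?num_real//.
      by rewrite lerXn2r// nnegrE.
    by rewrite sumr_const card_ord mulr_natl.
  have -> : S = dotv (\col_j (M i j)) v.
    by rewrite dotvE; apply: eq_bigr => j _; rewrite mxE.
  set w := \col__ _ => hw.
  (* Cauchy-Schwarz through the nonnegativity of |(v.v) w - (w.v) v|^2 *)
  have := nsq_ge0 (nsq v *: w - dotv w v *: v).
  rewrite nsqD nsqN dotvNr !nsqZ dotvZl dotvZr => cs.
  have [v0|v0] := leP (nsq v) 0.
    by rewrite (nsq_eq0 v0) dotv0r /nsq dotv0r expr0n mulr0.
  have {}cs : dotv w v ^+ 2 <= nsq w * nsq v.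
    rewrite -subr_ge0 -(pmulr_rge0 _ v0); apply: le_trans cs _.
    by apply: eq_imply_le; ring.
  by apply: le_trans cs _; rewrite ler_wpM2r// ltW.
apply: (@le_trans _ _ (\sum_(i < p) p%:R * e ^+ 2 * nsq v)); first exact: ler_sum.
by rewrite sumr_const card_ord; apply: eq_imply_le; rewrite -[LHS]mulr_natl; ring.
Qed.

End QuadraticForms.

(** * Resolvents of a nondecreasing family of semidefinite matrices and their limit *)

Section ResolventLimit.
Variables (R : realType) (p : nat) (W : R -> 'M[R]_p).
Implicit Types (s t : R) (v : 'cV[R]_p).
Hypothesis W_sym : forall t, 0 <= t -> (W t)^T = W t.
Hypothesis W_ge0 : forall t v, 0 <= t -> 0 <= qf (W t) v.
Hypothesis W_mono : forall s t v, 0 <= s -> s <= t -> qf (W s) v <= qf (W t) v.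

Local Notation Rv t := (invmx (1%:M + W t)).

Lemma resolvent_unit t : 0 <= t -> 1%:M + W t \in unitmx.
Proof.
move=> t0; rewrite -row_free_unit -kermx_eq0; apply/rowV0P => u /sub_kermxP u0.
apply/trmx_inj; rewrite trmx0; apply: nsq_eq0.
have : (1%:M + W t) *m u^T = 0.
  by rewrite -[LHS]trmxK trmx_mul trmxK linearD/= trmx1 W_sym// u0 trmx0.
move=> /(congr1 (dotv u^T)); rewrite mulmxDl mul1mx dotvDr dotv0r -/(nsq _) -/(qf _ _).
have := W_ge0 u^T t0; lra.
Qed.

Lemma resolvent_sym t : 0 <= t -> (Rv t)^T = Rv t.
Proof. by move=> t0; rewrite trmx_inv linearD/= trmx1 W_sym. Qed.

Lemma resolventP t v : 0 <= t -> v = Rv t *m v + W t *m (Rv t *m v).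
Proof.
by move=> t0; rewrite -[LHS](mulKVmx (resolvent_unit t0)) mulmxDl mul1mx.
Qed.

(** Expand [|y + W y|^2] with [y] the image of [v]: the cross term is [2 * qf W y]. *)
Lemma resolvent_qf t v : 0 <= t -> qf (W t) (Rv t *m v) <= nsq v / 2.
Proof.
move=> t0; set y := Rv t *m v; rewrite (resolventP v t0) -/y nsqD -/(qf _ _).
have := nsq_ge0 y; have := nsq_ge0 (W t *m y); lra.
Qed.

(** The removed part is [W y]; expanding [qf W v] along [v = y + W y] yields its squared norm and
    further nonnegative terms. *)
Lemma resolvent_close t v : 0 <= t -> nsq (v - Rv t *m v) <= qf (W t) v.
Proof.
move=> t0; set y := Rv t *m v; have e := resolventP v t0; rewrite -/y in e.
have -> : v - y = W t *m y by rewrite {1}e addrC addKr.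
rewrite e; set z := W t *m y; rewrite /qf mulmxDr -/z dotvDl !dotvDr.
rewrite -/(qf (W t) z) (dotv_mul (W t) y) W_sym// -/z -/(nsq z).
have := W_ge0 z t0; have := nsq_ge0 z; have : 0 <= dotv y z := W_ge0 y t0; lra.
Qed.

(** [qf (Rv t) v] is the maximum over [y] of [2 v.y - |y|^2 - qf (W t) y], which decreases as [W]
    grows. The maximizer at [t] serves as competitor at [s]. *)
Lemma resolvent_antimono s t v : 0 <= s -> s <= t -> qf (Rv t) v <= qf (Rv s) v.
Proof.
move=> s0 st; have t0 := le_trans s0 st.
pose ys := Rv s *m v; pose yt := Rv t *m v; rewrite /qf -/ys -/yt.
have es := resolventP v s0; have et := resolventP v t0; rewrite -/ys in es; rewrite -/yt in et.
have h1 := W_mono yt s0 st; have h2 := W_ge0 (ys - yt) s0.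
have h3 := nsq_ge0 (ys - yt).
have hs u : dotv u (W s *m ys) = dotv u v - dotv u ys by rewrite [in RHS]es dotvDr addrC addKr.
have ht u : dotv u (W t *m yt) = dotv u v - dotv u yt by rewrite [in RHS]et dotvDr addrC addKr.
have hst : dotv ys (W s *m yt) = dotv yt v - dotv yt ys.
  by rewrite dotv_mul W_sym// dotvC hs.
rewrite nsqD nsqN dotvNr /nsq in h3.
rewrite /qf !mulmxDr !mulmxN !dotvDl !dotvDr !dotvNl !dotvNr !hs hst in h2.
rewrite /qf ht in h1.
rewrite !(dotvC v); rewrite (dotvC ys yt) in h3; lra.
Qed.

Lemma nonincreasing_eventually (g : R -> R) :
  (forall t, 0 <= t -> 0 <= g t) -> (forall s t, 0 <= s -> s <= t -> g t <= g s) ->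
  exists l : R, forall e : R, 0 < e ->
    exists2 t1 : R, 0 <= t1 & forall t, t1 <= t -> `|g t - l| <= e.
Proof.
move=> g0 gm; pose A := [set g t | t in [set t | 0 <= t]].
have hA : has_inf A.
  split; first by exists (g 0), 0 => //=.
  by exists 0 => _ [t /= t0 <-]; apply: g0.
exists (inf A) => e e0.
have [_ [t1 /= t10 <-] h1] := inf_adherent e0 hA.
exists t1 => // t t1t; have t0 := le_trans t10 t1t.
have h2 : inf A <= g t by apply: ge_inf; [exact: hA.2|exists t].
rewrite ger0_norm ?subr_ge0//; have := gm _ _ t10 t1t; lra.
Qed.

(** Polarization, by which convergence passes from quadratic forms to entries. *)
Lemma qf_delta2 (M : 'M[R]_p) i j : M^T = M ->
  M i j = (qf M (delta_mx i 0 + delta_mx j 0) - qf M (delta_mx i 0) - qf M (delta_mx j 0)) / 2.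
Proof.
move=> sM; have e k l : dotv (delta_mx k 0) (M *m delta_mx l 0) = M k l.
  by rewrite /dotv trmx_delta -rowE -colE !mxE.
have eji : M j i = M i j by rewrite -{1}sM mxE.
by rewrite /qf mulmxDr dotvDl !dotvDr !e eji; clear; lra.
Qed.

Lemma eventually_forall (I : finType) (P : I -> R -> Prop) :
  (forall i, exists2 t1 : R, 0 <= t1 & forall t, t1 <= t -> P i t) ->
  exists2 t1 : R, 0 <= t1 & forall t, t1 <= t -> forall i, P i t.
Proof.
move=> /(_ _)/cid2 h.
exists (\sum_i s2val (h i)); first by apply: sumr_ge0 => i _; case: (h i).
move=> t ht i; apply: (s2valP' (h i)); apply: le_trans ht.
rewrite (bigD1 i)//= lerDl; apply: sumr_ge0 => j _; by case: (h j).
Qed.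

(** The first bound holds at all times although [W] may be unbounded: the resolvent at a much later
    time maps into vectors of small energy there, hence at [t] by monotonicity. The transpose is
    stated because a coordinate of [E x] is a pairing of [x] with a vector [E^T delta]. *)
Lemma resolvent_limit : exists E : 'M[R]_p,
  (forall t v, 0 <= t -> qf (W t) (E^T *m v) <= 2 * nsq v) /\
  (forall e : R, 0 < e -> exists2 t1 : R, 0 <= t1 & forall t, t1 <= t -> forall v,
     nsq (v - E *m v) <= 2 * qf (W t) v + e * nsq v).
Proof.
have hl v : exists l : R, forall e : R, 0 < e ->
    exists2 t1 : R, 0 <= t1 & forall t, t1 <= t -> `|qf (Rv t) v - l| <= e.
  apply: (nonincreasing_eventually (g := fun t => qf (Rv t) v)).
    move=> t t0; rewrite /qf; set y := Rv t *m v; rewrite (resolventP v t0) -/y.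
    rewrite dotvDl (dotvC (W t *m y)) -/(nsq y) -/(qf _ _).
    by rewrite addr_ge0// ?nsq_ge0// W_ge0.
  by move=> s t s0 st; apply: resolvent_antimono.
have {}hl i j : exists l : R, forall e : R, 0 < e ->
    exists2 t1 : R, 0 <= t1 & forall t, t1 <= t -> `|Rv t i j - l| <= e.
  have [l1 h1] := hl (delta_mx i 0 + delta_mx j 0).
  have [l2 h2] := hl (delta_mx i 0); have [l3 h3] := hl (delta_mx j 0).
  exists ((l1 - l2 - l3) / 2) => e e0.
  have e3 : 0 < e / 2 by lra.
  have [t1 t10 {}h1] := h1 _ e3; have [t2 t20 {}h2] := h2 _ e3; have [t3 t30 {}h3] := h3 _ e3.
  exists (t1 + t2 + t3); first lra.
  move=> t ht; rewrite (qf_delta2 i j (resolvent_sym _)); last lra.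
  have {}h1 := h1 t _; have {}h2 := h2 t _; have {}h3 := h3 t _.
  have {}h1 := h1 ltac:(lra); have {}h2 := h2 ltac:(lra); have {}h3 := h3 ltac:(lra).
  by move: h1 h2 h3; rewrite !ler_norml => /andP[? ?] /andP[? ?] /andP[? ?]; apply/andP; split; lra.
pose E : 'M[R]_p := \matrix_(i, j) projT1 (cid (hl i j)).
have hE (e : R) : 0 < e -> exists2 t1 : R, 0 <= t1 & forall t, t1 <= t -> forall ij : 'I_p * 'I_p,
    `|(Rv t - E) ij.1 ij.2| <= e.
  move=> e0; apply: (@eventually_forall _ (fun ij t => `|(Rv t - E) ij.1 ij.2| <= e)) => -[i j] /=.
  have [t1 t10 h] := projT2 (cid (hl i j)) e e0; exists t1 => // t tt1.
  by rewrite !mxE; apply: h.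
have {}hE (e : R) : 0 < e -> exists2 t1 : R, 0 <= t1 & forall t, t1 <= t -> forall v,
    nsq ((Rv t - E) *m v) <= e * nsq v /\ nsq ((Rv t - E)^T *m v) <= e * nsq v.
  move=> e0; pose N : R := p%:R * p%:R + 1.
  have N0 : 0 < N by rewrite ltr_wpDl// mulr_ge0.
  (* Entries within [e1] cost [p^2 e1^2] in squared norm; the cap at 1 allows [e1^2 <= e1]. *)
  pose e1 := Num.min 1 (e / N).
  have e10 : 0 < e1 by rewrite lt_min ltr01 divr_gt0.
  have e11 : p%:R * p%:R * e1 ^+ 2 <= e.
    have a1 : e1 <= 1 by rewrite ge_min lexx.
    have a2 : e1 * N <= e by rewrite -ler_pdivlMr// ge_min lexx orbT.
    have a3 : e1 ^+ 2 <= e1 by rewrite expr2 ler_piMr// ltW.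
    apply: le_trans a2; rewrite mulrC ler_pM// ?exprn_ge0// ?mulr_ge0//; first exact: ltW.
    by rewrite /N lerDl.
  have [t1 t10 h] := hE _ e10; exists t1 => // t tt1 v.
  have le2 (M : 'M[R]_p) : (forall i j, `|M i j| <= e1) -> nsq (M *m v) <= e * nsq v.
    by move=> hM; apply: le_trans (nsq_mul_small _ hM) _; rewrite ler_wpM2r// nsq_ge0.
  split; apply: le2 => i j; first exact: (h t tt1 (i, j)).
  by rewrite mxE; exact: (h t tt1 (j, i)).
exists E; split.
  move=> t v t0; have [L L0 hL] := qf_bound (W t).
  (* The tolerance is adapted to the size [L] of [W t] at the fixed [t]. The late resolvent and the
     error then contribute at most [nsq v] each, whence the constant 2. *)
  have e0 : 0 < (2 * (L + 1))^-1 by rewrite invr_gt0; lra.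
  have [t1 t10 h] := hE _ e0; pose t2 := t1 + t.
  have t20 : 0 <= t2 by rewrite addr_ge0.
  have t12 : t1 <= t2 by rewrite lerDl.
  have [_ h2] := h t2 t12 v.
  have -> : E^T *m v = Rv t2 *m v + - ((Rv t2 - E)^T *m v).
    by rewrite linearB/= resolvent_sym// mulmxBl opprB addrC subrK.
  apply: le_trans (qfD_le _ _ (fun w => W_ge0 w t0)) _.
  have h3 : qf (W t) (Rv t2 *m v) <= nsq v / 2.
    by apply: le_trans (W_mono _ t0 _) (resolvent_qf v t20); rewrite lerDr.
  have h4 := hL (- ((Rv t2 - E)^T *m v)); rewrite nsqN in h4.
  have h5 : L * ((2 * (L + 1))^-1 * nsq v) <= nsq v / 2.
    rewrite mulrA [leRHS]mulrC ler_wpM2r ?nsq_ge0// invfM mulrCA ler_piMr//.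
    by rewrite ler_pdivrMr; lra.
  have h6 := ler_wpM2l L0 h2; lra.
move=> e e0; have [t1 t10 h] := hE (e / 2) ltac:(lra).
exists t1 => // t tt1 v; have [h1 _] := h t tt1 v.
have -> : v - E *m v = (v - Rv t *m v) + (Rv t - E) *m v by rewrite mulmxBl addrA subrK.
apply: le_trans (nsqD_le _ _) _.
have := resolvent_close v (le_trans t10 tt1); lra.
Qed.

End ResolventLimit.

(** A path without repetition has at most [n] edges, and prepending an edge costs
    [2 M + 2 * 4^k M <= 4^(k+1) M]. *)
Lemma connect_nsq_le (R : realType) (n p : nat) (e : rel 'I_n) (z : 'I_n -> 'cV[R]_p) (M : R) i j :
  0 <= M -> (forall k l, e k l -> nsq (z k - z l) <= M) -> connect e i j ->
  nsq (z i - z j) <= 4 ^+ n * M.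
Proof.
move=> M0 eM /connectP[s0 /shortenP[s ps us _] ->].
have ss : (size s <= n)%N.
  by have := max_card (mem (i :: s)); rewrite (card_uniqP us) card_ord => /ltnW.
apply: (@le_trans _ _ (4 ^+ size s * M)); last first.
  by rewrite ler_wpM2r// ler_weXn2l// ler1n.
elim: s i ps {us ss} => [|k s IH] i /=.
  by move=> _; rewrite subrr mul1r /nsq dotv0r.
move=> /andP[/eM ik /IH h].
have -> : z i - z (last k s) = (z i - z k) + (z k - z (last k s)) by rewrite addrA subrK.
apply: le_trans (nsqD_le _ _) _; rewrite exprS.
have : 1 <= 4 ^+ size s :> R by rewrite exprn_ege1// ler1n.
nra.
Qed.

(** * Matrix-valued absolutely continuous functions *)

Section MoreAC.
Variable R : realType.
Local Notation mu := (@lebesgue_measure R).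

(** Local integrability on the half line, encoded by a primitive so that it feeds the comparison
    lemmas directly. *)
Definition loc (f : R -> R) := exists F, ac F f.
Definition acm p q (X F : R -> 'M[R]_(p, q)) :=
  forall i j, ac (fun t => X t i j) (fun t => F t i j).

Lemma ac_id : ac (fun t : R => t) (fun=> 1).
Proof.
move=> t t0; split; last first.
  rewrite Rintegral_cst//= mul1r add0r lebesgue_measure_itv/= lte_fin.
  by move: t0; rewrite le_eqVlt => /predU1P[<-|t0]; rewrite ?ltxx ?t0 /= ?oppr0 ?addr0 ?subr0.
have := (@continuous_compact_integrable R (fun=> 1 : R) `[0, t]).
by apply; [exact: segment_compact|apply: continuous_subspaceT => ?; exact: cvg_cst].
Qed.

Lemma ac_unique (x y f : R -> R) : ac x f -> ac y f -> x 0 = y 0 ->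
  forall t, 0 <= t -> x t = y t.
Proof. by move=> xf yf e t t0; rewrite (xf t t0).2 (yf t t0).2 e. Qed.

Lemma ac_loc (x f : R -> R) : ac x f -> loc f. Proof. by exists x. Qed.

Lemma loc_integrable f t : 0 <= t -> loc f -> mu.-integrable `[0, t] (EFin \o f).
Proof. by move=> t0 [F /(_ t t0)[]]. Qed.

Lemma integrable_loc f : (forall t, 0 <= t -> mu.-integrable `[0, t] (EFin \o f)) -> loc f.
Proof. by move=> /ac_primitive; exists (fun t => \int[mu]_(r in `[0, t]) f r). Qed.

Lemma loc_eq f g : (forall t, 0 <= t -> f t = g t) -> loc f -> loc g.
Proof. by move=> fg [F Ff]; exists F; apply: ac_eq Ff. Qed.

Lemma locM x f g : ac x f -> loc g -> loc (fun t => x t * g t).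
Proof.
move=> xf lg; apply: integrable_loc => t t0.
by apply: integrableM_cont xf _; apply: loc_integrable.
Qed.

Lemma ac_loc_self x f : ac x f -> loc x.
Proof. by move=> /locM/(_ (ac_loc ac_id)); apply: loc_eq => t _; rewrite mulr1. Qed.

Lemma loc_sum (I : Type) (r : seq I) (P : pred I) (f : I -> R -> R) :
  (forall i, loc (f i)) -> loc (fun t => \sum_(i <- r | P i) f i t).
Proof.
move=> /(_ _)/cid h; exists (fun t => \sum_(i <- r | P i) projT1 (h i) t).
by apply: ac_sum => i; exact: projT2 (h i).
Qed.

Lemma bounded_loc (w : R -> R) M : measurable_fun [set t : R | 0 <= t] w ->
  (forall t, 0 <= t -> 0 <= w t /\ w t <= M) -> loc w.
Proof.
move=> mw wM; apply: integrable_loc => t t0.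
apply: measurable_bounded_integrable => //.
- by rewrite /= lebesgue_measure_itv/= lte_fin; case: ifP => // _; rewrite ltry.
- by apply: measurable_funS mw => //; [rewrite -set_itvcy; exact: measurable_itv|
    move=> r /=; rewrite in_itv/= => /andP[]].
- exists M; split; first exact: num_real.
  move=> N MN r /=; rewrite in_itv/= => /andP[r0 _].
  by have [w0 wr] := wM r r0; rewrite ger0_norm// (le_trans wr)// ltW.
Qed.

Lemma acmD p q (X F Y G : R -> 'M[R]_(p, q)) : acm X F -> acm Y G ->
  acm (fun t => X t + Y t) (fun t => F t + G t).
Proof. by move=> XF YG i j; apply: ac_eq (acD (XF i j) (YG i j)) => t _; rewrite mxE. Qed.

Lemma acmN p q (X F : R -> 'M[R]_(p, q)) : acm X F -> acm (fun t => - X t) (fun t => - F t).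
Proof. by move=> XF i j; apply: ac_eq (acN (XF i j)) => t _; rewrite mxE. Qed.

Lemma acmB p q (X F Y G : R -> 'M[R]_(p, q)) : acm X F -> acm Y G ->
  acm (fun t => X t - Y t) (fun t => F t - G t).
Proof. by move=> XF YG; apply: acmD XF (acmN YG). Qed.

Lemma acm_cst p q (M : 'M[R]_(p, q)) : acm (fun=> M) (fun=> 0).
Proof. by move=> i j; apply: ac_eq (ac_cst (M i j)) => t _; rewrite ?mxE. Qed.

Lemma acmM p q r (X F : R -> 'M[R]_(p, q)) (Y G : R -> 'M[R]_(q, r)) : acm X F -> acm Y G ->
  acm (fun t => X t *m Y t) (fun t => F t *m Y t + X t *m G t).
Proof.
move=> XF YG i j.
have h := ac_sum (index_enum 'I_q) predT (fun k => acM (XF i k) (YG k j)).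
by apply: ac_eq h => t _; rewrite !mxE // -big_split.
Qed.

Lemma acmT p q (X F : R -> 'M[R]_(p, q)) : acm X F -> acm (fun t => (X t)^T) (fun t => (F t)^T).
Proof. by move=> XF i j; apply: ac_eq (XF j i) => t _; rewrite mxE. Qed.

Lemma ac_dotv p (x f y g : R -> 'cV[R]_p) : acm x f -> acm y g ->
  ac (fun t => dotv (x t) (y t)) (fun t => dotv (f t) (y t) + dotv (x t) (g t)).
Proof.
move=> xf yg; have := acmM (acmT xf) yg 0 0.
by apply: ac_eq => t _ //; rewrite mxE.
Qed.

(* The bound at the optimal k = m / C. *)
Lemma young_optimal (m C D : R) : 0 < C -> 0 <= D -> 0 <= m ->
  (forall k, 0 < k -> m <= k / 2 * C + D / (2 * k)) -> m ^+ 2 <= C * D.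
Proof.
move=> C0 D0; rewrite le_eqVlt => /predU1P[<- _|m0 h].
  by rewrite expr0n/= mulr_ge0// ltW.
have := h (m / C) (divr_gt0 m0 C0).
have -> : m / C / 2 * C = m / 2 by field; lra.
have -> : D / (2 * (m / C)) = C * D / (2 * m) by field; apply/andP; split; lra.
move=> {}h; have : m / 2 <= C * D / (2 * m) by lra.
by rewrite ler_pdivlMr ?mulr_gt0// expr2; lra.
Qed.

End MoreAC.

(** * Decay of the parameter errors *)

Section WindowArithmetic.
Variable R : realFieldType.

Lemma edge_arith (v vT D fk fkT fl flT c C N : R) : - vT - - v = D ->
  c * (fkT - fk) <= c * (C * N) -> c * (flT - fl) <= c * (C * N) -> D <= N ->
  2 * - vT + 4 * c * (fkT + flT) - (2 * - v + 4 * c * (fk + fl)) <= (2 + 8 * c * C) * N.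
Proof. move=> ? ? ? ?; lra. Qed.

Lemma excitation_arith (SB SF P mI c X N M : R) : 2 * SB <= 1 / mI * (2 * P) ->
  2 * SB + 4 * c * (X * (M * N)) + 4 * c * SF <=
  1 / mI * - - (2 * P) + (4 * c * M * (X * N) + 4 * c * SF).
Proof. by move=> ?; rewrite opprK; lra. Qed.

Lemma excitation_window_arith (vt vT mI N c M C3 C4 S ST t T : R) :
  4 * c * (ST - S) <= 4 * c * (M * (C3 * N)) -> mI * (- vT - - vt) <= mI * N ->
  mI * - vT + (4 * c * M * (C4 * N) * (t + T) + 4 * c * ST) -
  (mI * - vt + (4 * c * M * (C4 * N) * t + 4 * c * S)) <=
  (mI + 4 * c * M * (T * C4 + C3)) * N.
Proof. move=> ? ?; lra. Qed.

Lemma energy_window_arith (S ST Z t T M C3 C5 N : R) :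
  Z * T <= M * (2 * (C5 * N)) * T -> ST - S <= M * (C3 * N) ->
  2 * ST + Z * (t + T) - (2 * S + Z * t) <= M * (2 * C3 + 2 * T * C5) * N.
Proof. move=> ? ?; lra. Qed.

End WindowArithmetic.

Section CooperativeAdaptation.
Variables (R : realType) (n m d : nat) (a : 'I_n -> 'I_n -> R -> R) (aM delta T : R).
Variables (muF muIF gam ts : R) (Y : 'I_n -> R -> 'M[R]_(m, d)) (W : 'I_n -> R -> 'M[R]_d).
Variables (x dx : 'I_n -> R -> 'cV[R]_d).
Local Notation mu := (@lebesgue_measure R).
Hypotheses (delta0 : 0 < delta) (T0 : 0 < T) (aM0 : 0 < aM) (muF0 : 0 < muF) (muIF0 : 0 < muIF).
Hypotheses (gam0 : 0 < gam) (ts0 : 0 <= ts).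
Hypothesis a_meas : forall i j, measurable_fun [set t : R | 0 <= t] (a i j).
Hypothesis a_bd : forall i j (t : R), 0 <= t -> 0 <= a i j t /\ a i j t <= aM.
Hypothesis a_sym : forall i j (t : R), 0 <= t -> a i j t = a j i t.
Hypothesis a_conn : jointly_connected a delta T.
Hypothesis W_ac : forall i, acm (W i) (fun t => (Y i t)^T *m Y i t).
Hypothesis W_0 : forall i, W i 0 = 0.
Hypothesis x_ac : forall i, acm (x i) (dx i).
Hypothesis dxE : forall i t, 0 <= t -> dx i t =
  - (muF *: ((Y i t)^T *m (Y i t *m x i t)) + muIF *: (W i t *m x i t)
     + \sum_j a i j t *: (x i t - x j t)).
Hypothesis excited : forall v, gam * nsq v <= \sum_i qf (W i ts) v.
Implicit Types (i j : 'I_n) (t r : R).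

Let A i t := nsq (Y i t *m x i t).
Let B i t := qf (W i t) (x i t).
Let L i j t := a i j t * nsq (x i t - x j t).
(** Half of the decay rate of [V]. The factor 1/2 on the coupling reflects that the double sum meets
    each undirected edge twice. *)
Let P t := muF * \sum_i A i t + muIF * \sum_i B i t + 2^-1 * \sum_i \sum_j L i j t.
Let V t := \sum_i nsq (x i t).

Lemma ac_qfW i v : ac (fun t => qf (W i t) v) (fun t => nsq (Y i t *m v)).
Proof.
have h := acmM (W_ac i) (acm_cst v).
have := ac_dotv (acm_cst v) h; apply: ac_eq => t _ //.
rewrite mulmx0 addr0 {1}/dotv trmx0 mul0mx mxE add0r.
by rewrite -mulmxA dotv_mul trmxK.
Qed.

Lemma gramian_sym i t : 0 <= t -> (W i t)^T = W i t.
Proof.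
move=> t0; apply/matrixP => k l.
have h : ac (fun t => W i t k l) (fun t => ((Y i t)^T *m Y i t)^T k l).
  by apply: ac_eq (W_ac i k l) => r _ //; rewrite trmx_mul trmxK.
by apply: ac_unique (acmT (W_ac i) k l) h _ _ t0; rewrite W_0 trmx0.
Qed.

Lemma gramian_mono i s t v : 0 <= s -> s <= t -> qf (W i s) v <= qf (W i t) v.
Proof.
move=> s0 st; rewrite -subr_ge0.
have := ac_le (ac_cst 0) (ac_qfW i v) s0 st (fun r _ _ => nsq_ge0 _).
by rewrite subrr.
Qed.

Lemma gramian_ge0 i t v : 0 <= t -> 0 <= qf (W i t) v.
Proof.
move=> t0; have := gramian_mono i v (lexx 0) t0.
by rewrite {1}/qf W_0 mul0mx dotv0r.
Qed.

Lemma regression_ge0 i t : 0 <= A i t. Proof. exact: nsq_ge0. Qed.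
Lemma gramian_energy_ge0 i t : 0 <= t -> 0 <= B i t. Proof. exact: gramian_ge0. Qed.
Lemma coupling_ge0 i j t : 0 <= t -> 0 <= L i j t.
Proof. by move=> t0; rewrite mulr_ge0 ?nsq_ge0//; case: (a_bd i j t0). Qed.

Lemma agent_dissipation_le i t : 0 <= t ->
  muF * A i t + muIF * B i t + \sum_j L i j t <= 2 * P t.
Proof.
move=> t0.
have h1 : A i t <= \sum_i A i t.
  by rewrite (bigD1 i)//= lerDl sumr_ge0// => j _; exact: regression_ge0.
have h2 : B i t <= \sum_i B i t.
  by rewrite (bigD1 i)//= lerDl sumr_ge0// => j _; exact: gramian_energy_ge0.
have h3 : \sum_j L i j t <= \sum_i \sum_j L i j t.
  rewrite [leRHS](bigD1 i)//= lerDl sumr_ge0// => k _.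
  by rewrite sumr_ge0// => j _; exact: coupling_ge0.
have h4 : 0 <= A i t by exact: regression_ge0.
have h5 := gramian_energy_ge0 i t0.
have h6 := ler_wpM2l (ltW muF0) h1; have h7 := ler_wpM2l (ltW muIF0) h2.
have h8 : 0 <= muF * A i t by rewrite mulr_ge0// ltW.
have h9 : 0 <= muIF * B i t by rewrite mulr_ge0// ltW.
rewrite /P; lra.
Qed.

Lemma gramian_dissipation_le t : 0 <= t -> muIF * \sum_i B i t <= P t.
Proof.
move=> t0; have h1 : 0 <= \sum_i A i t by rewrite sumr_ge0// => j _; exact: regression_ge0.
have h2 : 0 <= \sum_i \sum_j L i j t.
  by rewrite sumr_ge0// => k _; rewrite sumr_ge0// => j _; exact: coupling_ge0.
have h3 := mulr_ge0 (ltW muF0) h1; rewrite /P; lra.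
Qed.

Lemma dissipation_ge0 t : 0 <= t -> 0 <= P t.
Proof.
move=> t0; apply: le_trans (gramian_dissipation_le t0).
by apply: mulr_ge0; [exact: ltW|apply: sumr_ge0 => j _; exact: gramian_energy_ge0].
Qed.

Lemma ac_parameter_energy : ac V (fun t => - (2 * P t)).
Proof.
have := ac_sum (index_enum 'I_n) predT (fun i => ac_dotv (x_ac i) (x_ac i)).
apply: ac_eq => t t0 //.
transitivity (\sum_i (- (2 * (muF * A i t)) - 2 * (muIF * B i t)
    - 2 * \sum_j a i j t * dotv (x i t) (x i t - x j t))).
  apply: eq_bigr => i _; rewrite (dotvC (dx i t)) dxE// dotvNr !dotvDr !dotvZr dotv_sumr.
  rewrite dotv_mul trmxK -/(nsq _) -/(A i t) -/(qf _ _) -/(B i t).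
  under [\sum_(_ | _) dotv _ _]eq_bigr => j _ do rewrite dotvZr.
  ring.
rewrite !big_split/= !sumrN -!mulr_sumr /P.
have -> : \sum_i \sum_j a i j t * dotv (x i t) (x i t - x j t) =
    2^-1 * \sum_i \sum_j L i j t.
  (* Exchanging the indices, with symmetric weights, turns the pairing with [x i] into minus the
     pairing with [x j]; the two together form the squared difference. *)
  have e : \sum_i \sum_j a i j t * dotv (x i t) (x i t - x j t) =
      - \sum_i \sum_j a i j t * dotv (x j t) (x i t - x j t).
    rewrite [LHS]exchange_big/= -sumrN; apply: eq_bigr => i _.
    rewrite -sumrN; apply: eq_bigr => j _; rewrite a_sym// -mulrN -dotvNr opprB//.
  have e2 : \sum_i \sum_j L i j t = \sum_i \sum_j a i j t * dotv (x i t) (x i t - x j t) -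
      \sum_i \sum_j a i j t * dotv (x j t) (x i t - x j t).
    rewrite -sumrB; apply: eq_bigr => i _; rewrite -sumrB; apply: eq_bigr => j _.
    by rewrite -mulrBr /L {1}/nsq dotvDl dotvNl.
  by rewrite e2 -e; field.
ring.
Qed.

Lemma parameter_energy_noninc s t : 0 <= s -> s <= t -> V t <= V s.
Proof.
move=> s0 st; have := ac_le ac_parameter_energy (ac_cst 0) s0 st; rewrite subrr subr_le0; apply.
by move=> r sr _; rewrite oppr_le0 mulr_ge0// dissipation_ge0// (le_trans s0).
Qed.

Lemma parameter_energy_ge0 t : 0 <= V t.
Proof. by rewrite sumr_ge0// => i _; exact: nsq_ge0. Qed.

(* Young's inequality bounds the speed of [dotv u (x i)] by the dissipation, for every weight k. *)
Lemma projected_movement i (u : 'cV[R]_d) (K : R) t s : 0 <= t -> t <= s -> s <= t + T ->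
  (forall r : R, 0 <= r -> qf (W i r) u <= K) ->
  (dotv u (x i s) - dotv u (x i t)) ^+ 2 <=
    (muF * K + (muIF * K + n%:R * aM * nsq u) * T + 1) * (V t - V (t + T)).
Proof.
move=> t0 lets sT uK; have s0 := le_trans t0 lets.
have K0 : 0 <= K by apply: le_trans (uK _ (lexx 0)); exact: gramian_ge0.
have hq0 : 0 <= n%:R * aM * nsq u by rewrite !mulr_ge0 ?nsq_ge0// ltW.
set q := n%:R * aM * nsq u in hq0 *.
have VsT : V (t + T) <= V s by apply: parameter_energy_noninc.
have Vst : V s <= V t by apply: parameter_energy_noninc.
have FK0 : 0 <= muF * K by rewrite mulr_ge0// ltW.
have IK0 : 0 <= muIF * K by rewrite mulr_ge0// ltW.
(* The summand 1 in the constant provides the strict positivity asked by [young_optimal]. *)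
rewrite -real_normK ?num_real//; apply: young_optimal => //.
- by rewrite ltr_wpDl// addr_ge0// mulr_ge0 ?(ltW T0)// addr_ge0.
- by rewrite subr_ge0 (le_trans VsT).
move=> k k0.
have aL := ac_dotv (acm_cst u) (x_ac i).
(* The comparison primitive: [nsq (Y i r *m u)] is the rate of the Gramian energy of [u], so it
   integrates to at most [K]; the constant rates act for a time at most [T]; and [- V] has rate
   [2 * P]. *)
have aR := acD (acD (acZ (k / 2 * muF) (ac_qfW i u)) (acZ (k / 2 * (muIF * K + q)) (@ac_id R)))
   (acZ (1 / (2 * k)) (acN ac_parameter_energy)).
apply: le_trans (ac_norm_le aL aR t0 lets _) _; last first.
  have h1 : k / 2 * muF * qf (W i s) u <= k / 2 * muF * K.
    by rewrite ler_wpM2l ?uK// mulr_ge0 ?ltW// divr_gt0.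
  have h2 : 0 <= k / 2 * muF * qf (W i t) u.
    by rewrite mulr_ge0 ?gramian_ge0// mulr_ge0 ?ltW// divr_gt0.
  have h3 : k / 2 * (muIF * K + q) * (s - t) <= k / 2 * (muIF * K + q) * T.
    by rewrite ler_wpM2l; [| |lra]; rewrite // mulr_ge0// ?addr_ge0// ltW// divr_gt0.
  have h4 : (V t - V s) / (2 * k) <= (V t - V (t + T)) / (2 * k).
    by rewrite ler_wpM2r ?invr_ge0 ?lerD2l ?lerN2// mulr_ge0// ltW.
  have h5 : 0 <= k / 2 by rewrite divr_ge0// ltW.
  move: h3 h4; rewrite !(mulrDr, mulrDl, mulrBl, mulrBr, mulNr, mulrN, mul1r, mulr1) !mulrA; lra.
move=> r tr rs; have r0 := le_trans t0 tr.
have z0 : dotv 0 (x i r) = 0 by rewrite dotvC dotv0r.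
rewrite z0 add0r dxE// dotvNr normrN !dotvDr !dotvZr dotv_sumr.
have hA : `|dotv u ((Y i r)^T *m (Y i r *m x i r))| <= k / 2 * nsq (Y i r *m u) + A i r / (2 * k).
  by rewrite dotv_mul trmxK; exact: young.
have hB : `|dotv u (W i r *m x i r)| <= k / 2 * K + B i r / (2 * k).
  apply: le_trans (qf_young u (x i r) (gramian_sym i r0) (fun v => gramian_ge0 i v r0) k0) _.
  by rewrite lerD2r ler_wpM2l// ?uK// divr_ge0// ltW.
have hL : `|\sum_j dotv u (a i j r *: (x i r - x j r))| <= k / 2 * q + (\sum_j L i j r) / (2 * k).
  apply: le_trans (ler_norm_sum _ _ _) _.
  have -> : k / 2 * q = \sum_(j < n) k / 2 * (aM * nsq u).
    by rewrite sumr_const card_ord -mulr_natl /q; ring.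
  rewrite mulr_suml -big_split; apply: ler_sum => j _ /=.
  have [aj0 ajM] := a_bd i j r0.
  rewrite dotvZr normrM (ger0_norm aj0).
  apply: le_trans (ler_wpM2l aj0 (young u _ k0)) _.
  have -> : a i j r * (k / 2 * nsq u + nsq (x i r - x j r) / (2 * k)) =
      k / 2 * (a i j r * nsq u) + L i j r / (2 * k) by rewrite /L; ring.
  rewrite lerD2r; apply: ler_wpM2l; first by rewrite divr_ge0// ltW.
  by rewrite ler_wpM2r ?nsq_ge0.
have h := agent_dissipation_le i r0.
have h2 : (muF * A i r + muIF * B i r + \sum_j L i j r) / (2 * k) <= 2 * P r / (2 * k).
  by rewrite ler_wpM2r// invr_ge0 mulr_ge0// ltW.
apply: le_trans (ler_normD _ _) _; apply: le_trans (lerD (ler_normD _ _) (lexx _)) _.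
rewrite !normrM (gtr0_norm muF0) (gtr0_norm muIF0).
have hA' := ler_wpM2l (ltW muF0) hA; have hB' := ler_wpM2l (ltW muIF0) hB.
move: h2 hA' hB' hL.
rewrite !(mulrDr, mulrDl, mulrBl, mulrBr, mulNr, mulrN, opprK, mul1r, mulr1) !mulrA.
lra.
Qed.

(** Coordinate [c] of [E i *m x i] is the pairing of [x i] with [u i c], whose Gramian energy never
    exceeds [K c]; [projected_movement] applies to each coordinate with constant [C1 i c]. *)
Lemma projected_estimates : exists (C : R) (E : 'I_n -> 'M[R]_d), [/\ 0 <= C,
  forall i t s, 0 <= t -> t <= s -> s <= t + T ->
    nsq (E i *m x i s - E i *m x i t) <= C * (V t - V (t + T)) &
  forall e : R, 0 < e -> exists2 t1 : R, 0 <= t1 & forall t, t1 <= t -> forall i,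
    nsq (x i t - E i *m x i t) <= 2 * B i t + e * nsq (x i t)].
Proof.
have hE i := cid (resolvent_limit (@gramian_sym i) (@gramian_ge0 i) (@gramian_mono i)).
pose E i := projT1 (hE i).
pose u i c : 'cV[R]_d := (E i)^T *m delta_mx c 0.
pose K c : R := 2 * nsq (delta_mx c 0 : 'cV[R]_d).
pose C1 i c := muF * K c + (muIF * K c + n%:R * aM * nsq (u i c)) * T + 1.
have C10 i c : 0 <= C1 i c.
  have K0 : 0 <= K c by rewrite mulr_ge0// nsq_ge0.
  have h1 : 0 <= muF * K c by rewrite mulr_ge0// ltW.
  have h2 : 0 <= muIF * K c by rewrite mulr_ge0// ltW.
  have h3 : 0 <= n%:R * aM * nsq (u i c) by rewrite !mulr_ge0 ?nsq_ge0// ltW.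
  by rewrite addr_ge0// addr_ge0// mulr_ge0 ?(ltW T0)// addr_ge0.
exists (\sum_i \sum_c C1 i c), E; split.
- by do 2 rewrite sumr_ge0 => // *.
- move=> i t s t0 lets sT.
  have D0 : 0 <= V t - V (t + T) by rewrite subr_ge0 parameter_energy_noninc// lerDl ltW.
  apply: (@le_trans _ _ ((\sum_c C1 i c) * (V t - V (t + T)))); last first.
    rewrite ler_wpM2r// [leRHS](bigD1 i)//= lerDl sumr_ge0// => j _.
    by rewrite sumr_ge0// => c _; exact: C10.
  rewrite nsqE mulr_suml; apply: ler_sum => c _.
  have eE v : (E i *m v) c 0 = dotv (u i c) v.
    by rewrite /u -dotv_mul /dotv trmx_delta -rowE [RHS]mxE.
  have -> : (E i *m x i s - E i *m x i t) c 0 = dotv (u i c) (x i s) - dotv (u i c) (x i t).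
    by rewrite -!eE !mxE.
  apply: projected_movement => // r r0.
  exact: (projT2 (hE i)).1.
- move=> e e0; apply: (@eventually_forall _ _ (fun i t =>
    nsq (x i t - E i *m x i t) <= 2 * B i t + e * nsq (x i t))) => i.
  have [t1 t10 h] := (projT2 (hE i)).2 e e0; exists t1 => // t tt1.
  exact: h.
Qed.

Lemma window_estimate : exists2 C : R, 0 <= C & forall e : R, 0 < e ->
  exists2 t1 : R, 0 <= t1 & forall t, t1 <= t ->
    T * V (t + T) <= C * (V t - V (t + T) + e * V t).
Proof.
have T0' := T0; have ts0' := ts0; have aM0' := aM0.
have [C2 [E [C20 hmove hclose]]] := projected_estimates.
have [Lam Lam0 hLam] : exists2 Lam : R, 0 <= Lam & forall i v, qf (W i ts) v <= Lam * nsq v.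
  have h i := cid2 (qf_bound (W i ts)).
  exists (\sum_i s2val (h i)); first by rewrite sumr_ge0// => i _; case: (h i).
  move=> i v; apply: le_trans (s2valP' (h i) v) _; rewrite ler_wpM2r ?nsq_ge0//.
  by rewrite (bigD1 i)//= lerDl sumr_ge0// => j _; case: (h j).
(* [C3] bounds the integral of [|x_i - z_i|^2] over a window: [2 / muIF] from the dissipated Gramian
   energy, [2 * T] from the [e] term, [2 * C2 * T] from the movement of [E i *m x i]. *)
pose C3 := 2 / muIF + 2 * T + 2 * C2 * T.
have C30 : 0 <= C3.
  have h1 : 0 <= 2 / muIF by rewrite divr_ge0// ltW.
  have := mulr_ge0 C20 (ltW T0); rewrite /C3; lra.
(* Disagreement across one edge of integrated weight at least [delta], times the path factor of
   [connect_nsq_le]. *)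
pose C4 := 4 ^+ n * ((2 + 8 * aM * C3) / delta).
have C40 : 0 <= C4.
  rewrite mulr_ge0 ?exprn_ge0// divr_ge0 ?(ltW delta0)//.
  by have := mulr_ge0 (ltW aM0) C30; lra.
(* Size of a single [z i]: the excitation level [gam] is integrated over a window, hence the
   division by [T * gam]. *)
pose C5 := (1 / muIF + 4 * Lam * n%:R * (T * C4 + C3)) / (T * gam).
have C50 : 0 <= C5.
  rewrite divr_ge0 ?mulr_ge0 ?(ltW T0) ?(ltW gam0)// addr_ge0 ?divr_ge0 ?(ltW muIF0)//.
  by rewrite !mulr_ge0// addr_ge0// mulr_ge0// ltW.
exists (n%:R * (2 * C3 + 2 * T * C5)).
  have h1 := mulr_ge0 (ltW T0) C50; apply: mulr_ge0 => //; lra.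
move=> e e0; have [t1 t10 {}hclose] := hclose e e0.
(* From [ts] on, the exciting Gramians [W j ts] lie below the current ones, whose energy is
   dissipated. *)
exists (t1 + ts); first by rewrite addr_ge0.
move=> t ht; have t0 : 0 <= t by lra.
have tT : t <= t + T by rewrite lerDl ltW.
set D := V t - V (t + T); set N := D + e * V t.
have D0 : 0 <= D by rewrite subr_ge0 parameter_energy_noninc.
have eV0 : 0 <= e * V t by rewrite mulr_ge0 ?parameter_energy_ge0// ltW.
have N0 : 0 <= N by rewrite addr_ge0.
(* Reference values frozen at the start of the window; being constant, they can be tested against
   integrated weights and excitation. *)
pose z i := E i *m x i t.
have xz_ac i := acmB (x_ac i) (acm_cst (z i)).
have hF i := cid (ac_loc_self (ac_dotv (xz_ac i) (xz_ac i))).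
pose F i := projT1 (hF i).
have aF i : ac (F i) (fun r => nsq (x i r - z i)) := projT2 (hF i).
have aT := @ac_id R.
have a2V := acN ac_parameter_energy.
have VD : - V (t + T) - - V t = D by rewrite /D opprK addrC.
have hFi i : F i (t + T) - F i t <= C3 * N.
  have aR := acD (acZ (2 / muIF) a2V) (acZ (2 * e * V t + 2 * C2 * D) aT).
  apply: le_trans (ac_le (aF i) aR t0 tT _) _.
    move=> r tr rT; have r0 := le_trans t0 tr.
    have -> : x i r - z i = (x i r - E i *m x i r) + (E i *m x i r - z i) by rewrite addrA subrK.
    apply: le_trans (nsqD_le _ _) _.
    have h1 := hmove i t r t0 tr rT; rewrite -/(z i) -/D in h1.
    have h2 : nsq (x i r - E i *m x i r) <= 2 * B i r + e * nsq (x i r).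
      by apply: hclose; lra.
    have h3 : e * nsq (x i r) <= e * V t.
      rewrite ler_pM2l//; apply: le_trans (parameter_energy_noninc t0 tr).
      by rewrite /V (bigD1 i)//= lerDl sumr_ge0// => j _; exact: nsq_ge0.
    have h4 : 4 * B i r <= 2 / muIF * (2 * P r).
      have -> : 4 * B i r = 2 / muIF * (2 * (muIF * B i r)) by field; rewrite gt_eqF.
      rewrite ler_wpM2l// ?divr_ge0 ?(ltW muIF0)// ler_pM2l//.
      apply: le_trans (gramian_dissipation_le r0); rewrite ler_wpM2l ?(ltW muIF0)//.
      by rewrite (bigD1 i)//= lerDl sumr_ge0// => j _; exact: gramian_energy_ge0.
    lra.
  have -> : 2 / muIF * - V (t + T) + (2 * e * V t + 2 * C2 * D) * (t + T) -
     (2 / muIF * - V t + (2 * e * V t + 2 * C2 * D) * t) =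
     (2 / muIF) * D + (2 * T) * (e * V t) + (2 * C2 * T) * D by rewrite /D; ring.
  have h1 : 0 <= (2 / muIF) * (e * V t) by rewrite mulr_ge0// divr_ge0// ltW.
  have h2 : 0 <= (2 * T) * D by apply: mulr_ge0 => //; apply: mulr_ge0 => //; exact: ltW.
  have h3 : 0 <= (2 * C2 * T) * (e * V t).
    by apply: mulr_ge0 => //; apply: mulr_ge0; [exact: mulr_ge0|exact: ltW].
  rewrite /C3 /N; lra.
have hz i j : nsq (z i - z j) <= C4 * N.
  rewrite /C4 -mulrA; apply: connect_nsq_le (a_conn t0 i j).
    by rewrite mulr_ge0// divr_ge0 ?(ltW delta0)//; have := mulr_ge0 (ltW aM0) C30; lra.
  move=> k l kl; rewrite mulrAC ler_pdivlMr// mulrC.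
  have [w aw] := bounded_loc (a_meas k l) (a_bd k l).
  rewrite -(ac_diff aw t0 tT) in kl.
  apply: le_trans (ler_wpM2r (nsq_ge0 _) kl) _.
  have aw2 := acZ (nsq (z k - z l)) aw.
  have aR := acD (acZ 2 a2V) (acZ (4 * aM) (acD (aF k) (aF l))).
  rewrite mulrC mulrBr; apply: le_trans (ac_le aw2 aR t0 tT _) _.
    move=> r tr rT; have r0 := le_trans t0 tr.
    have [ak0 akM] := a_bd k l r0.
    have -> : z k - z l = (x k r - x l r) + ((x l r - z l) - (x k r - z k)).
      by apply/matrixP => ? ?; rewrite !mxE; ring.
    have h1 : nsq (x k r - x l r + (x l r - z l - (x k r - z k))) <=
        2 * nsq (x k r - x l r) + 4 * (nsq (x k r - z k) + nsq (x l r - z l)).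
      apply: le_trans (nsqD_le _ _) _; have := nsqB_le (x l r - z l) (x k r - z k); lra.
    rewrite mulrC; apply: le_trans (ler_wpM2l ak0 h1) _.
    have h2 : a k l r * nsq (x k r - x l r) <= 2 * P r.
      have := agent_dissipation_le k r0; have : 0 <= muF * A k r by rewrite mulr_ge0 ?regression_ge0// ltW.
      have : 0 <= muIF * B k r by rewrite mulr_ge0 ?gramian_energy_ge0// ltW.
      have : L k l r <= \sum_j L k j r.
        by rewrite (bigD1 l)//= lerDl sumr_ge0// => j' _; exact: coupling_ge0.
      rewrite /L; lra.
    have h3 : a k l r * (nsq (x k r - z k) + nsq (x l r - z l)) <=
         aM * (nsq (x k r - z k) + nsq (x l r - z l)).
      by rewrite ler_wpM2r// addr_ge0// nsq_ge0.
    lra.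
  have hk := ler_wpM2l (ltW aM0) (hFi k); have hl := ler_wpM2l (ltW aM0) (hFi l).
  have h0 : D <= N by rewrite /N lerDl.
  exact: (edge_arith VD hk hl h0).
have hzi i : nsq (z i) <= C5 * N.
  rewrite /C5 mulrAC ler_pdivlMr ?mulr_gt0// mulrC.
  have aL := acZ (gam * nsq (z i)) aT.
  have aS : ac (fun r => \sum_j F j r) (fun r => \sum_j nsq (x j r - z j)) := ac_sum _ _ aF.
  have aR := acD (acZ (1 / muIF) a2V) (acD (acZ (4 * Lam * n%:R * (C4 * N)) aT) (acZ (4 * Lam) aS)).
  have -> : T * gam * nsq (z i) = gam * nsq (z i) * (t + T) - gam * nsq (z i) * t by ring.
  apply: le_trans (ac_le aL aR t0 tT _) _.
    move=> r tr rT; have r0 := le_trans t0 tr; rewrite !mulr1.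
    apply: le_trans (excited _) _.
    have hj j : qf (W j ts) (z i) <= 2 * B j r + 4 * Lam * (C4 * N) + 4 * Lam * nsq (x j r - z j).
      have -> : z i = x j r + (z i - x j r) by rewrite addrC subrK.
      apply: le_trans (qfD_le _ _ (fun v => gramian_ge0 j v ts0)) _.
      have h1 : qf (W j ts) (x j r) <= B j r by apply: gramian_mono => //; lra.
      have h2 := hLam j (z i - x j r).
      have h3 : nsq (z i - x j r) <= 2 * (C4 * N) + 2 * nsq (x j r - z j).
        have -> : z i - x j r = (z i - z j) - (x j r - z j).
          by apply/matrixP => ? ?; rewrite !mxE; ring.
        by apply: le_trans (nsqB_le _ _) _; have := hz i j; lra.
      have := ler_wpM2l Lam0 h3; lra.
    apply: le_trans (ler_sum _ (fun j _ => hj j)) _.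
    rewrite !big_split/= -!mulr_sumr sumr_const card_ord -[_ *+ n]mulr_natl.
    have h1 : 2 * \sum_j B j r <= 1 / muIF * (2 * P r).
      by rewrite mul1r ler_pdivlMl// mulrCA ler_pM2l// gramian_dissipation_le.
    exact: (excitation_arith _ _ _ _ _ h1).
  have hS : \sum_j F j (t + T) - \sum_j F j t <= n%:R * (C3 * N).
    rewrite -sumrB; apply: le_trans (ler_sum _ (fun j _ => hFi j)) _.
    by rewrite sumr_const card_ord mulr_natl.
  have h1 := ler_wpM2l (mulr_ge0 (ler0n _ 4) Lam0) hS.
  have h2 : 1 / muIF * D <= 1 / muIF * N by rewrite ler_wpM2l ?divr_ge0 ?(ltW muIF0)// lerDl.
  rewrite -VD in h2.
  exact: (excitation_window_arith C4 t T h1 h2).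
have aL := acZ (V (t + T)) aT.
have aS : ac (fun r => \sum_j F j r) (fun r => \sum_j nsq (x j r - z j)) := ac_sum _ _ aF.
have aR := acD (acZ 2 aS) (acZ (\sum_i 2 * nsq (z i)) aT).
have -> : T * V (t + T) = V (t + T) * (t + T) - V (t + T) * t by ring.
apply: le_trans (ac_le aL aR t0 tT _) _.
  move=> r tr rT; rewrite !mulr1; apply: le_trans (parameter_energy_noninc (le_trans t0 tr) rT) _.
  rewrite mulr_sumr -big_split; apply: ler_sum => j _ /=.
  by have := nsqD_le (x j r - z j) (z j); rewrite subrK.
have hS : \sum_j F j (t + T) - \sum_j F j t <= n%:R * (C3 * N).
  rewrite -sumrB; apply: le_trans (ler_sum _ (fun j _ => hFi j)) _.
  by rewrite sumr_const card_ord mulr_natl.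
have hS2 : \sum_i 2 * nsq (z i) <= n%:R * (2 * (C5 * N)).
  rewrite mulr_natl -[X in _ <= _ *+ X]card_ord -sumr_const; apply: ler_sum => j _.
  by rewrite ler_pM2l// hzi.
exact: (energy_window_arith t (ler_wpM2r (ltW T0) hS2) hS).
Qed.

Theorem cooperative_decay : exists c rho : R, [/\ 0 <= c, 0 < rho &
  forall t, 0 <= t -> \sum_i nsq (x i t) <= c * expR (- rho * t)].
Proof.
have T0' := T0; have [C C0 hC] := window_estimate.
(* For this [e] the error [C * e * V t] is at most [T / 2 * V t], which leaves the contraction
   factor [(C + T / 2) / (C + T)]. *)
have e0 : 0 < T / (2 * (C + 1)) by rewrite divr_gt0//; lra.
have [t1 t10 ht1] := hC _ e0.
have CT : 0 < C + T by rewrite ltr_wpDl.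
apply: (@window_contraction _ V ((C + T / 2) / (C + T)) t1 T (V 0)) => //.
- by rewrite ltr_pdivrMr// mul1r ltrD2l; lra.
- by move=> t _; exact: parameter_energy_ge0.
- move=> t tt1; have := ht1 t tt1.
  rewrite [X in _ -> _ <= X]mulrAC ler_pdivlMr// => h.
  have h2 : C * (T / (2 * (C + 1)) * V t) <= T / 2 * V t.
    have -> : C * (T / (2 * (C + 1)) * V t) = T / 2 * V t * (C / (C + 1)).
      by field; rewrite gt_eqF// ltr_wpDl.
    rewrite ler_piMr//; first by rewrite mulr_ge0 ?parameter_energy_ge0// divr_ge0// ltW.
    by rewrite ler_pdivrMr ?mul1r ?lerDl// ltr_wpDl.
  lra.
- by move=> t t0 _; exact: parameter_energy_noninc.
Qed.

End CooperativeAdaptation.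

(** * Consensus under a vanishing perturbation *)

Section PerturbedConsensus.
Variables (R : realType) (n : nat) (a : 'I_n -> 'I_n -> R -> R) (aM delta T : R).
Variables (sig c rho : R) (s f g : 'I_n -> R -> R).
Local Notation mu := (@lebesgue_measure R).
Hypotheses (delta0 : 0 < delta) (T0 : 0 < T) (aM0 : 0 < aM) (sig0 : 0 < sig) (rho0 : 0 < rho).
Hypothesis a_meas : forall i j, measurable_fun [set t : R | 0 <= t] (a i j).
Hypothesis a_bd : forall i j (t : R), 0 <= t -> 0 <= a i j t /\ a i j t <= aM.
Hypothesis a_sym : forall i j (t : R), 0 <= t -> a i j t = a j i t.
Hypothesis a_conn : jointly_connected a delta T.
Hypothesis s_ac : forall i, ac (s i) (f i).
Hypothesis fE : forall i (t : R), 0 <= t -> f i t =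
  - sig * \sum_j a i j t * (s i t - s j t) + g i t.
Hypothesis g_bd : forall i (t : R), 0 <= t -> `|g i t| <= c * expR (- rho * t).
Implicit Types (i j : 'I_n) (t r : R).

Let G t := c * expR (- rho * t).
Let l i j t := a i j t * (s i t - s j t) ^+ 2.
Let L t := \sum_i \sum_j l i j t.
(** Pairwise differences ignore a common drift of the [s i], which the perturbation may cause. *)
Let V t := \sum_i \sum_j (s i t - s j t) ^+ 2.

Lemma edge_disagreement_ge0 i j t : 0 <= t -> 0 <= l i j t.
Proof. by move=> t0; rewrite mulr_ge0 ?sqr_ge0//; case: (a_bd i j t0). Qed.

Lemma agent_disagreement_le i t : 0 <= t -> \sum_j l i j t <= L t.
Proof.
move=> t0; rewrite /L [leRHS](bigD1 i)//= lerDl sumr_ge0// => k _.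
by rewrite sumr_ge0// => j _; exact: edge_disagreement_ge0.
Qed.

Lemma edge_disagreement_le i j t : 0 <= t -> l i j t <= L t.
Proof.
move=> t0; apply: le_trans (agent_disagreement_le i t0).
by rewrite (bigD1 j)//= lerDl sumr_ge0// => k _; exact: edge_disagreement_ge0.
Qed.

Lemma disagreement_ge0 t : 0 <= t -> 0 <= L t.
Proof. by move=> t0; rewrite sumr_ge0// => i _; rewrite sumr_ge0// => j _; exact: edge_disagreement_ge0. Qed.

Lemma sqr_difference_le i j t : (s i t - s j t) ^+ 2 <= V t.
Proof.
rewrite /V (bigD1 i)//= (bigD1 j)//= -addrA lerDl addr_ge0// sumr_ge0// => k _.
  by rewrite sqr_ge0.
by rewrite sumr_ge0// => k' _; rewrite sqr_ge0.
Qed.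

Lemma ac_sqr (x dx : R -> R) : ac x dx -> ac (fun t => x t ^+ 2) (fun t => 2 * x t * dx t).
Proof. by move=> xd; apply: ac_eq (acM xd xd) => t _; rewrite ?expr2//; ring. Qed.

Lemma loc_disagreement : loc L.
Proof.
apply: loc_sum => i; apply: loc_sum => j.
apply: (loc_eq (f := fun t => (s i t - s j t) ^+ 2 * a i j t)).
  by move=> t _; rewrite mulrC.
exact: locM (ac_sqr (acB (s_ac i) (s_ac j))) (bounded_loc (a_meas i j) (a_bd i j)).
Qed.

Lemma perturbation_bound_ge0 i t : 0 <= t -> 0 <= G t.
Proof. by move=> t0; apply: le_trans (g_bd i t0). Qed.

Lemma perturbation_bound_noninc i t r : 0 <= t -> t <= r -> G r <= G t.
Proof.
move=> t0 tr; have c0 : 0 <= c.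
  by have := perturbation_bound_ge0 i (lexx 0); rewrite /G mulr0 expR0 mulr1.
by rewrite ler_wpM2l// ler_expR !mulNr lerN2 ler_pM2l.
Qed.

(** The coupling terms [p i] sum to zero, so the products [s i * p j] cancel in the double sum and
    the diagonal ones are counted [n] times. *)
Lemma ac_sq_diffs : ac V (fun t =>
  - (2 * n%:R * sig) * L t + \sum_i \sum_j 2 * (s i t - s j t) * (g i t - g j t)).
Proof.
have h i := ac_sum (index_enum 'I_n) predT (fun j => ac_sqr (acB (s_ac i) (s_ac j))).
have {h} := ac_sum (index_enum 'I_n) predT h.
apply: ac_eq => t t0 //=.
pose p i := \sum_j a i j t * (s i t - s j t).
have p0 : \sum_i p i = 0.
  have e : \sum_i p i = \sum_i \sum_j a j i t * (s j t - s i t) by rewrite /p exchange_big.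
  have e2 : \sum_i \sum_j a j i t * (s j t - s i t) = - \sum_i p i.
    rewrite -sumrN; apply: eq_bigr => i _; rewrite /p -sumrN; apply: eq_bigr => j _.
    by rewrite (a_sym j i t0); ring.
  lra.
have psL : 2 * \sum_i s i t * p i = L t.
  have e : \sum_i s i t * p i = \sum_i \sum_j a i j t * (s i t * (s i t - s j t)).
    by apply: eq_bigr => i _; rewrite /p mulr_sumr; apply: eq_bigr => j _; rewrite mulrCA.
  have e2 : \sum_i s i t * p i = - \sum_i \sum_j a i j t * (s j t * (s i t - s j t)).
    rewrite e exchange_big/= -sumrN; apply: eq_bigr => i _.
    by rewrite -sumrN; apply: eq_bigr => j _; rewrite (a_sym j i t0); ring.
  rewrite mulr_natl mulr2n {1}e e2 -sumrB; apply: eq_bigr => i _; rewrite -sumrB.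
  by apply: eq_bigr => j _; rewrite /l; ring.
transitivity (\sum_i \sum_j (- (2 * sig) * (s i t * p i + s j t * p j - s i t * p j - s j t * p i) +
   2 * (s i t - s j t) * (g i t - g j t))).
  apply: eq_bigr => i _; apply: eq_bigr => j _; rewrite !fE// -/(p i) -/(p j); ring.
have -> : \sum_i \sum_j (- (2 * sig) * (s i t * p i + s j t * p j - s i t * p j - s j t * p i) +
   2 * (s i t - s j t) * (g i t - g j t)) =
   \sum_i \sum_j (- (2 * sig) * (s i t * p i + s j t * p j - s i t * p j - s j t * p i)) +
   \sum_i \sum_j 2 * (s i t - s j t) * (g i t - g j t).
  by rewrite -big_split; apply: eq_bigr => i _; rewrite -big_split.
congr (_ + _).
under eq_bigr => i _ do rewrite -mulr_sumr !sumrB big_split/= -!mulr_suml -!mulr_sumr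
  sumr_const card_ord p0 mulr0 subr0.
rewrite -mulr_sumr sumrB big_split/= -mulr_sumr p0 mulr0 subr0.
under eq_bigr => i _ do rewrite -mulr_natl -mulrA.
by rewrite -mulr_sumr sumr_const card_ord -psL -[X in _ + X]mulr_natl; ring.
Qed.

(** Young's inequality at every weight gives the square root of the dissipation; the perturbation
    adds at most [G t * T], as [G] does not increase. *)
Lemma difference_movement i t r A1 : 0 <= t -> t <= r -> r <= t + T -> 0 <= A1 ->
  (forall F, ac F L -> F r - F t <= A1) ->
  (s i r - s i t) ^+ 2 <= (2 * ((sig * n%:R * aM * T + 1) * sig) + 2 * T ^+ 2) * (A1 + G t ^+ 2).
Proof.
move=> t0 tr rT A0 hA; have [F aF] := loc_disagreement.
have T0' := T0; have sig0' := sig0; have G0 := perturbation_bound_ge0 i t0.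
set C1 := sig * n%:R * aM * T + 1.
have C10 : 0 < C1.
  by rewrite /C1 ltr_wpDl// mulr_ge0 ?(ltW T0)// mulr_ge0 ?(ltW aM0)// mulr_ge0// ltW.
have key k : 0 < k -> `|s i r - s i t| - G t * T <= k / 2 * C1 + (sig * A1) / (2 * k).
  move=> k0; have k20 : 0 <= k / 2 by rewrite divr_ge0// ltW.
  have aR := acD (acZ (k / 2 * (sig * n%:R * aM) + G t) (@ac_id R)) (acZ (sig / (2 * k)) aF).
  have := ac_norm_le (s_ac i) aR t0 tr; rewrite /= => h.
  have {}h : `|s i r - s i t| <= (k / 2 * (sig * n%:R * aM) + G t) * r + sig / (2 * k) * F r -
      ((k / 2 * (sig * n%:R * aM) + G t) * t + sig / (2 * k) * F t).
    apply: h => w tw wr; have w0 := le_trans t0 tw.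
    rewrite fE// mulr1; apply: le_trans (ler_normD _ _) _.
    have hg : `|g i w| <= G t by apply: le_trans (g_bd i w0) _; exact: perturbation_bound_noninc.
    rewrite mulNr normrN normrM (gtr0_norm sig0).
    have hs : `|\sum_j a i j w * (s i w - s j w)| <= k / 2 * (n%:R * aM) + L w / (2 * k).
      apply: le_trans (ler_norm_sum _ _ _) _.
      apply: (@le_trans _ _ (\sum_j (k / 2 * aM + l i j w / (2 * k)))).
        apply: ler_sum => j _; have [a0 aMj] := a_bd i j w0.
        rewrite normrM (ger0_norm a0).
        have h1 : `|s i w - s j w| <= k / 2 + (s i w - s j w) ^+ 2 / (2 * k).
          rewrite -[X in _ <= _ + X / _]real_normK ?num_real//; set v := `|_|.
          have -> : k / 2 + v ^+ 2 / (2 * k) = (k ^+ 2 + v ^+ 2) / (2 * k) by field; rewrite gt_eqF.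
          by rewrite ler_pdivlMr ?mulr_gt0//; have := sqr_ge0 (v - k); lra.
        apply: le_trans (ler_wpM2l a0 h1) _.
        have -> : a i j w * (k / 2 + (s i w - s j w) ^+ 2 / (2 * k)) =
            k / 2 * a i j w + l i j w / (2 * k) by rewrite /l; ring.
        by rewrite lerD2r ler_wpM2l.
      rewrite big_split/= sumr_const card_ord -mulr_suml -mulr_natl.
      apply: lerD; first by apply: eq_imply_le; ring.
      by rewrite ler_wpM2r ?agent_disagreement_le// invr_ge0 mulr_ge0// ltW.
    have := ler_wpM2l (ltW sig0) hs; rewrite mulrDr !mulrA; move: hg.
    have -> : sig / (2 * k) * L w = sig * L w / (2 * k) by ring.
    lra.
  have h1 : sig / (2 * k) * (F r - F t) <= sig / (2 * k) * A1.
    by rewrite ler_wpM2l ?hA// divr_ge0 ?mulr_ge0 ?(ltW sig0) ?(ltW k0).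
  have h2 : (k / 2 * (sig * n%:R * aM) + G t) * (r - t) <= (k / 2 * (sig * n%:R * aM) + G t) * T.
    rewrite ler_wpM2l; [by []| |lra].
    by rewrite addr_ge0// mulr_ge0// mulr_ge0 ?(ltW aM0)// mulr_ge0// ltW.
  have -> : sig * A1 / (2 * k) = sig / (2 * k) * A1 by ring.
  rewrite /C1; lra.
have GT : 0 <= G t * T by rewrite mulr_ge0// ltW.
have sA : 0 <= sig * A1 by rewrite mulr_ge0// ltW.
have h : `|s i r - s i t| ^+ 2 <= 2 * (C1 * (sig * A1)) + 2 * (G t * T) ^+ 2.
  have [h|h] := leP 0 (`|s i r - s i t| - G t * T).
    by have := young_optimal C10 sA h key; have := sqr_ge0 (`|s i r - s i t| - 2 * (G t * T)); lra.
  have h1 : `|s i r - s i t| ^+ 2 <= (G t * T) ^+ 2.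
    by rewrite lerXn2r ?nnegrE//; lra.
  have := mulr_ge0 (ltW C10) sA; have := sqr_ge0 (G t * T); lra.
move: h; rewrite real_normK ?num_real// => h; apply: le_trans h _.
have h1 : 0 <= C1 * sig * G t ^+ 2 by rewrite mulr_ge0 ?sqr_ge0// mulr_ge0// ltW.
have h2 : 0 <= T ^+ 2 * A1 by rewrite mulr_ge0// sqr_ge0.
rewrite exprMn; lra.
Qed.

Lemma consensus_window i0 : exists C nu : R, [/\ 0 <= C, 0 < nu, nu <= 1 & forall t, 0 <= t ->
  V (t + T) <= (1 - nu) * V t + C * G t ^+ 2].
Proof.
have T0' := T0; have sig0' := sig0; have aM0' := aM0; have delta0' := delta0.
have n0 : 1 <= n%:R :> R by rewrite ler1n; case: n i0 => // -[].
have [F aF] := loc_disagreement.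
set C2 := 2 * ((sig * n%:R * aM * T + 1) * sig) + 2 * T ^+ 2.
have C20 : 0 <= C2.
  have h1 : 0 <= sig * n%:R * aM * T.
    by rewrite mulr_ge0 ?(ltW T0)// mulr_ge0 ?(ltW aM0)// mulr_ge0// ltW.
  rewrite /C2 addr_ge0// ?mulr_ge0 ?sqr_ge0 ?(ltW sig0)//; lra.
pose C3 := 4 ^+ n * ((2 + 8 * aM * T * C2) / delta).
have C30 : 0 <= C3.
  rewrite mulr_ge0 ?exprn_ge0// divr_ge0 ?(ltW delta0)//.
  have : 0 <= aM * T * C2 by rewrite !mulr_ge0// ltW.
  lra.
pose N2 : R := n%:R * n%:R.
have N20 : 0 <= N2 by rewrite mulr_ge0.
have sum2 (h : 'I_n -> 'I_n -> R) M : (forall i j, h i j <= M) -> \sum_i \sum_j h i j <= N2 * M.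
  move=> hM; apply: (@le_trans _ _ (\sum_(i < n) \sum_(j < n) M)).
    by apply: ler_sum => i _; apply: ler_sum => j _.
  by rewrite !sumr_const !card_ord -mulrnA -mulr_natl natrM.
pose C4 := N2 * C3 + n%:R * sig + 1.
have nsig0 : 0 < n%:R * sig by rewrite mulr_gt0//; lra.
have C40 : 0 < C4 by rewrite /C4; have := mulr_ge0 N20 C30; lra.
pose C5 := N2 * (2 * C3 + 8 * C2) + 1.
have C50 : 0 < C5.
  rewrite /C5; have := mulr_ge0 N20 C30; have := mulr_ge0 N20 C20; lra.
(* Young weight for the perturbation: the term [eta * V] then costs [n * sig * N] over the window,
   which takes half of the dissipation [2 * n * sig * A1] plus a multiple of [G t ^+ 2]. *)
pose eta := n%:R * sig / (T * C5).
have eta0 : 0 < eta by rewrite divr_gt0// mulr_gt0.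
(* The other half pays for [nu * V t], because [V t <= N2 * (C3 * N)]; the extra summands of [C4]
   keep [nu <= 1]. *)
pose nu := n%:R * sig / C4.
pose C6 := n%:R * sig + N2 * 4 / eta * T.
exists (C6 + n%:R * sig), nu; split.
- rewrite /C6; have : 0 <= N2 * 4 / eta * T.
    by rewrite mulr_ge0 ?(ltW T0)// divr_ge0 ?(ltW eta0)// mulr_ge0.
  lra.
- by rewrite divr_gt0.
- by rewrite ler_pdivrMr// mul1r /C4; have := mulr_ge0 N20 C30; lra.
move=> t t0; have tT : t <= t + T by lra.
set A1 := F (t + T) - F t.
have A10 : 0 <= A1.
  have := ac_le (ac_cst 0) aF t0 tT; rewrite subrr; apply => r tr _.
  by apply: disagreement_ge0; exact: le_trans tr.
have G0 := perturbation_bound_ge0 i0 t0.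
set N := A1 + G t ^+ 2.
have N0 : 0 <= N by rewrite addr_ge0// sqr_ge0.
have hm i r : t <= r -> r <= t + T -> (s i r - s i t) ^+ 2 <= C2 * N.
  move=> tr rT; apply: difference_movement => // F' aF'.
  rewrite /A1; have r0 := le_trans t0 tr.
  have e := ac_le aF' aF t0 tr (fun _ _ _ => lexx _).
  have e2 : F r <= F (t + T).
    rewrite -subr_ge0; have := ac_le (ac_cst 0) aF r0 rT; rewrite subrr; apply => w rw _.
    by apply: disagreement_ge0; exact: le_trans rw.
  lra.
have hd i j r : t <= r -> r <= t + T ->
    ((s i t - s j t) - (s i r - s j r)) ^+ 2 <= 4 * (C2 * N).
  move=> tr rT; have := hm i r tr rT; have := hm j r tr rT.
  have := sqr_ge0 ((s i r - s i t) + (s j r - s j t)); lra.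
have h3 i j : (s i t - s j t) ^+ 2 <= C3 * N.
  (* Scalars as vectors of length one, to reuse the path estimate. *)
  pose z i : 'cV[R]_1 := const_mx (s i t).
  have zE k k' : nsq (z k - z k') = (s k t - s k' t) ^+ 2.
    by rewrite nsqE big_ord1 !mxE.
  rewrite -zE /C3 -mulrA; apply: connect_nsq_le (a_conn t0 i j).
    rewrite mulr_ge0// divr_ge0 ?(ltW delta0)//.
    have : 0 <= aM * T * C2 by rewrite !mulr_ge0// ltW.
    lra.
  move=> k k' kk; rewrite zE mulrAC ler_pdivlMr// mulrC.
  have [w aw] := bounded_loc (a_meas k k') (a_bd k k').
  rewrite -(ac_diff aw t0 tT) in kk.
  apply: le_trans (ler_wpM2r (sqr_ge0 _) kk) _.
  have aw2 := acZ ((s k t - s k' t) ^+ 2) aw.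
  have aR := acD (acZ 2 aF) (acZ (8 * aM * C2 * N) (@ac_id R)).
  rewrite mulrC mulrBr; apply: le_trans (ac_le aw2 aR t0 tT _) _.
    move=> r tr rT; have r0 := le_trans t0 tr.
    have [a0 aMk] := a_bd k k' r0.
    have h1 : (s k t - s k' t) ^+ 2 <= 2 * (s k r - s k' r) ^+ 2 + 8 * (C2 * N).
      have := hd k k' r tr rT.
      have := sqr_ge0 ((s k t - s k' t) - 2 * (s k r - s k' r)); lra.
    have h2 := ler_wpM2l a0 h1; have h4 := edge_disagreement_le k k' r0; rewrite /l in h4.
    have h5 : a k k' r * (C2 * N) <= aM * (C2 * N) by rewrite ler_wpM2r// mulr_ge0.
    lra.
  have h1 : 0 <= G t ^+ 2 by rewrite sqr_ge0.
  have h2 : A1 <= N by rewrite /N; lra.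
  have -> : 2 * F (t + T) + 8 * aM * C2 * N * (t + T) - (2 * F t + 8 * aM * C2 * N * t) =
     2 * A1 + 8 * aM * T * C2 * N by rewrite /A1; ring.
  lra.
have hV r : t <= r -> r <= t + T -> V r <= C5 * N.
  move=> tr rT; apply: (@le_trans _ _ (N2 * (2 * (C3 * N) + 8 * (C2 * N)))); last first.
    by rewrite /C5; lra.
  apply: sum2 => i j; have := h3 i j; have := hd i j r tr rT.
  have := sqr_ge0 ((s i r - s j r) - 2 * (s i t - s j t)); lra.
have hVt : V t <= N2 * (C3 * N) by apply: sum2.
have aR := acD (acZ (- (2 * n%:R * sig)) aF)
   (acZ (eta * (C5 * N) + N2 * (4 / eta * G t ^+ 2)) (@ac_id R)).
have := ac_le ac_sq_diffs aR t0 tT; rewrite /= => h.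
have {}h : V (t + T) - V t <=
    - (2 * n%:R * sig) * A1 + (eta * (C5 * N) + N2 * (4 / eta * G t ^+ 2)) * T.
  have -> : - (2 * n%:R * sig) * A1 + (eta * (C5 * N) + N2 * (4 / eta * G t ^+ 2)) * T =
    - (2 * n%:R * sig) * F (t + T) + (eta * (C5 * N) + N2 * (4 / eta * G t ^+ 2)) * (t + T) -
    (- (2 * n%:R * sig) * F t + (eta * (C5 * N) + N2 * (4 / eta * G t ^+ 2)) * t).
    by rewrite /A1; ring.
  apply: h => r tr rT; have r0 := le_trans t0 tr; rewrite mulr1 lerD2l.
  apply: (@le_trans _ _ (\sum_i \sum_j (eta * (s i r - s j r) ^+ 2 + 4 / eta * G t ^+ 2))).
    apply: ler_sum => i _; apply: ler_sum => j _.
    have hg k : `|g k r| <= G t by apply: le_trans (g_bd k r0) _; exact: (perturbation_bound_noninc i0).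
    set v := s i r - s j r; set w := g i r - g j r.
    have hw : w ^+ 2 <= 4 * G t ^+ 2.
      have -> : 4 * G t ^+ 2 = (2 * G t) ^+ 2 by ring.
      rewrite -real_normK ?num_real// lerXn2r ?nnegrE//; first by rewrite mulr_ge0.
      by apply: le_trans (ler_normB _ _) _; have := hg i; have := hg j; lra.
    have hw2 : w ^+ 2 / eta <= 4 * G t ^+ 2 / eta by rewrite ler_wpM2r// invr_ge0 ltW.
    have : 0 <= (eta * v - w) ^+ 2 / eta by rewrite divr_ge0 ?sqr_ge0// ltW.
    have -> : (eta * v - w) ^+ 2 / eta = eta * v ^+ 2 - 2 * v * w + w ^+ 2 / eta.
      by field; rewrite gt_eqF.
    have -> : 4 / eta * G t ^+ 2 = 4 * G t ^+ 2 / eta by ring.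
    lra.
  have -> : \sum_i \sum_j (eta * (s i r - s j r) ^+ 2 + 4 / eta * G t ^+ 2) =
      eta * V r + N2 * (4 / eta * G t ^+ 2).
    under eq_bigr => i _ do rewrite big_split/= -mulr_sumr sumr_const card_ord.
    by rewrite big_split/= -mulr_sumr sumr_const card_ord -mulrnA -[X in _ + X]mulr_natl natrM.
  by rewrite lerD2r ler_wpM2l ?hV// ltW.
have e1 : eta * (C5 * N) * T = n%:R * sig * N.
  by rewrite /eta; field; rewrite !gt_eqF.
have h4 : nu * V t <= n%:R * sig * N.
  rewrite /nu mulrAC ler_pdivrMr//.
  have -> : n%:R * sig * N * C4 = n%:R * sig * (C4 * N) by ring.
  rewrite ler_wpM2l ?(ltW nsig0)//; apply: le_trans hVt _.
  by rewrite /C4; have := mulr_ge0 (ltW nsig0) N0; lra.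
have e2 : N2 * (4 / eta * G t ^+ 2) * T = N2 * 4 / eta * T * G t ^+ 2 by ring.
move: h; rewrite (mulrDl (eta * (C5 * N))) e1 e2 /C6; move: h4; rewrite /N; lra.
Qed.

Theorem perturbed_consensus : exists C r0 : R, [/\ 0 <= C, 0 < r0 & forall t, 0 <= t ->
  forall i j, (s i t - s j t) ^+ 2 <= C * expR (- r0 * t)].
Proof.
have [[i0 _]|ni] := pselect (exists i : 'I_n, True); last first.
  by exists 0, 1; split => // t _ i; case: ni; exists i.
have T0' := T0; have rho0' := rho0.
have [C [nu [C0 nu0 nu1 hC]]] := consensus_window i0.
pose ga : R := expR (- rho * T) ^+ 2.
have ga1 : ga < 1.
  by rewrite /ga exprn_ilt1// ?expR_ge0// -expR0 ltr_expR; nra.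
have ga0 : 0 <= ga by rewrite sqr_ge0.
(* [G ^+ 2] shrinks by [ga] per window. Added to [V] with this weight, it absorbs the forcing, since
   [C + K * ga = (1 + ga) / 2 * K]. *)
pose K := 2 * C / (1 - ga).
have K0 : 0 <= K by rewrite divr_ge0 ?mulr_ge0// subr_ge0 ltW.
have hK : C + K * ga <= (1 + ga) / 2 * K.
  have : K * (1 - ga) = 2 * C by rewrite /K divfK// gt_eqF// subr_gt0.
  lra.
pose Phi t := V t + K * G t ^+ 2.
have V0 t : 0 <= V t by rewrite sumr_ge0// => i _; rewrite sumr_ge0// => j _; rewrite sqr_ge0.
have [M [mr hM]] := @ac_bounded _ _ _ T ac_sq_diffs.
pose kap := Num.max (1 - nu) ((1 + ga) / 2).
have [||||||c1 [r1 [c10 r10 h]]] := @window_contraction R Phi kap 0 T (`|M| + 1 + K * G 0 ^+ 2).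
- by [].
- by [].
- by rewrite gt_max; apply/andP; split; lra.
- by move=> t t0; rewrite /Phi addr_ge0// mulr_ge0// sqr_ge0.
- move=> t t0; rewrite /Phi.
  have -> : G (t + T) ^+ 2 = ga * G t ^+ 2.
    by rewrite /G mulrDr expRD /ga; ring.
  have G2 : 0 <= G t ^+ 2 by rewrite sqr_ge0.
  have k1 : (1 - nu) * V t <= kap * V t by apply: ler_wpM2r; rewrite ?V0// /kap le_max lexx.
  have k2 : (1 + ga) / 2 * (K * G t ^+ 2) <= kap * (K * G t ^+ 2).
    by apply: ler_wpM2r; [exact: mulr_ge0|rewrite /kap le_max lexx orbT].
  have := ler_wpM2r G2 hK; have := hC t t0; lra.
- move=> t t0; rewrite add0r => tT; apply: lerD.
    have := hM (`|M| + 1) _ t; rewrite /= in_itv/= t0 tT => hh.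
    apply: le_trans (ler_norm _) (hh _ isT).
    by apply: le_lt_trans (ler_norm _) _; lra.
  rewrite ler_wpM2l// lerXn2r ?nnegrE ?(perturbation_bound_ge0 i0)//.
  exact: (perturbation_bound_noninc i0).
exists c1, r1; split => // t t0 i j; apply: le_trans (sqr_difference_le i j t) _.
by apply: le_trans (h t t0); rewrite lerDl mulr_ge0// sqr_ge0.
Qed.

End PerturbedConsensus.

(** * Exponentially decaying signals *)

Section ExpDecay.
Variable R : realType.
Implicit Types (f g : R -> R) (t : R).

(** Constant and rate are existential, so the closure lemmas need not track them. *)
Definition expdecay f := exists c rho : R, [/\ 0 <= c, 0 < rho &
  forall t, 0 <= t -> `|f t| <= c * expR (- rho * t)].

Lemma expR_rate_le (r1 r2 t : R) : 0 <= t -> r1 <= r2 -> expR (- r2 * t) <= expR (- r1 * t).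
Proof. by move=> t0 r12; rewrite ler_expR ler_wpM2r// lerN2. Qed.

Lemma expdecay_le f g : (forall t, 0 <= t -> `|f t| <= `|g t|) -> expdecay g -> expdecay f.
Proof.
move=> fg [c [r [c0 r0 h]]]; exists c, r; split => // t t0.
by apply: le_trans (fg t t0) _; exact: h.
Qed.

Lemma expdecay_eq f g : (forall t, 0 <= t -> g t = f t) -> expdecay g -> expdecay f.
Proof. by move=> e; apply: expdecay_le => t /e ->. Qed.

Lemma expdecayD f g : expdecay f -> expdecay g -> expdecay (fun t => f t + g t).
Proof.
move=> [c [r [c0 r0 h]]] [c1 [r1 [c10 r10 h1]]].
exists (c + c1), (Num.min r r1); split; [exact: addr_ge0|by rewrite lt_min r0|].
move=> t t0; apply: le_trans (ler_normD _ _) _; rewrite mulrDl lerD//.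
  by apply: le_trans (h t t0) _; rewrite ler_wpM2l// expR_rate_le// ge_min lexx.
by apply: le_trans (h1 t t0) _; rewrite ler_wpM2l// expR_rate_le// ge_min lexx orbT.
Qed.

Lemma expdecayZ (k : R) f : expdecay f -> expdecay (fun t => k * f t).
Proof.
move=> [c [r [c0 r0 h]]]; exists (`|k| * c), r; split; [exact: mulr_ge0|by []|].
by move=> t t0; rewrite normrM -mulrA ler_wpM2l// h.
Qed.

Lemma expdecayN f : expdecay f -> expdecay (fun t => - f t).
Proof. by apply: expdecay_le => t _; rewrite normrN. Qed.

Lemma expdecayB f g : expdecay f -> expdecay g -> expdecay (fun t => f t - g t).
Proof. by move=> hf /expdecayN; exact: expdecayD. Qed.

Lemma expdecay_bounded_mul (w : R -> R) (M : R) f :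
  (forall t, 0 <= t -> `|w t| <= M) -> expdecay f -> expdecay (fun t => w t * f t).
Proof.
move=> wM hf; apply: expdecay_le (expdecayZ M hf) => t t0.
rewrite !normrM ler_wpM2r//; apply: le_trans (wM t t0) (ler_norm _).
Qed.

Lemma expdecay_norm f : expdecay f -> expdecay (fun t => `|f t|).
Proof. by apply: expdecay_le => t _; rewrite normr_id. Qed.

Lemma expdecay0 : expdecay (fun=> 0).
Proof. by exists 0, 1; split => // t _; rewrite normr0 mul0r. Qed.

Lemma expdecay_sum (I : Type) (r : seq I) (P : pred I) (f : I -> R -> R) :
  (forall i, expdecay (f i)) -> expdecay (fun t => \sum_(i <- r | P i) f i t).
Proof.
move=> hf; elim: r => [|i r IH].
  by apply: expdecay_eq expdecay0 => t _; rewrite big_nil.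
have [Pi|Pi] := boolP (P i).
  by apply: expdecay_eq (expdecayD (hf i) IH) => t _; rewrite big_cons Pi.
by apply: expdecay_eq IH => t _; rewrite big_cons (negbTE Pi).
Qed.

Lemma expdecay_uniform (I : finType) (f : I -> R -> R) : (forall i, expdecay (f i)) ->
  exists c rho : R, [/\ 0 <= c, 0 < rho &
    forall i t, 0 <= t -> `|f i t| <= c * expR (- rho * t)].
Proof.
move=> hf; have [|c [r [c0 r0 h]]] := @expdecay_sum _ (index_enum I) predT (fun i t => `|f i t|).
  by move=> i; apply: expdecay_le (hf i) => t _; rewrite normr_id.
exists c, r; split => // i t t0; apply: le_trans (h t t0).
apply: le_trans (ler_norm _); rewrite (bigD1 i)//= lerDl; exact: sumr_ge0.
Qed.

Lemma expdecay_sqrt f (c rho : R) : 0 <= c -> 0 < rho ->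
  (forall t, 0 <= t -> f t ^+ 2 <= c * expR (- rho * t)) -> expdecay f.
Proof.
(* [c <= (c + 1) ^+ 2] avoids a square root of the constant. *)
move=> c0 r0 h; exists (c + 1), (rho / 2); split; [by rewrite addr_ge0|by rewrite divr_gt0|].
move=> t t0; have e0 : 0 <= (c + 1) * expR (- (rho / 2) * t).
  by rewrite mulr_ge0 ?expR_ge0// addr_ge0.
rewrite -(@ler_pXn2r _ 2)// ?nnegrE// real_normK ?num_real//.
apply: le_trans (h t t0) _; rewrite exprMn [expR _ ^+ 2]expr2 -expRD.
have -> : - (rho / 2) * t + - (rho / 2) * t = - rho * t by field.
by rewrite ler_wpM2r ?expR_ge0//; have := sqr_ge0 c; lra.
Qed.

Lemma expdecay_filter (p f : R -> R) (k : R) : 0 < k -> ac p f ->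
  expdecay (fun t => f t + k * p t) -> expdecay p.
Proof.
move=> k0 pf [c [r [c0 r0 h]]].
(* [stable_filter_decay] needs a rate strictly below [k]. *)
pose r1 := Num.min r (k / 2).
have r1k : r1 < k by rewrite gt_min; apply/orP; right; lra.
exists (`|p 0| + c / (k - r1)), r1; split.
- by rewrite addr_ge0// divr_ge0// subr_ge0 ltW.
- by rewrite lt_min r0/= divr_gt0.
- apply: (stable_filter_decay pf r1k) => t t0; apply: le_trans (h t t0) _.
  by rewrite ler_wpM2l// expR_rate_le// ge_min lexx.
Qed.

Lemma expdecay_primitive_bounded (p f : R -> R) : ac p f -> expdecay f ->
  exists B, forall t, 0 <= t -> `|p t| <= B.
Proof.
move=> pf [c [r [c0 r0 h]]]; exists (`|p 0| + c / r) => t t0.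
have aR := acZ (- c / r) (ac_expR (- r)).
have := ac_norm_le pf aR (lexx 0) t0; rewrite mulr0 expR0 mulr1 => h2.
have {}h2 : `|p t - p 0| <= - c / r * expR (- r * t) - - c / r.
  apply: h2 => w w0 _; apply: le_trans (h w w0) _.
  by rewrite mulrA mulrN mulNr divfK ?gt_eqF// opprK.
have := ler_normD (p t - p 0) (p 0); rewrite subrK => h3.
have : 0 <= c / r * expR (- r * t) by rewrite mulr_ge0 ?expR_ge0// divr_ge0// ltW.
lra.
Qed.

Lemma mx_norm_le p q (M : 'M[R]_(p, q)) (B : R) : 0 <= B ->
  (forall i j, `|M i j| <= B) -> `|M| <= B.
Proof.
move=> B0 h; rewrite /Num.norm/= mx_normrE; by apply/bigmax_leP; split.
Qed.

Lemma expdecay_cvg0 p q (F : R -> 'M[R]_(p, q)) :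
  (forall i j, expdecay (fun t => F t i j)) -> F t @[t --> +oo] --> (0 : 'M[R]_(p, q)).
Proof.
move=> hF; have [c [r [c0 r0 h]]] :=
  @expdecay_uniform _ (fun ij t => F t ij.1 ij.2) (fun ij => hF ij.1 ij.2).
apply/cvgr0Pnorm_lt => e e0.
(* Sufficient by [1 + r * t <= expR (r * t)]. *)
exists (c / e / r); split; first exact: num_real.
move=> t ht; have t0 : 0 <= t by apply: le_trans (ltW ht); rewrite !divr_ge0// ltW.
apply: (@le_lt_trans _ _ (c * expR (- r * t))).
  by apply: mx_norm_le => [|i j]; [rewrite mulr_ge0// expR_ge0|exact: (h (i, j))].
rewrite mulNr expRN ltr_pdivrMr ?expR_gt0// -ltr_pdivrMl//.
apply: lt_le_trans (expR_ge1Dx _); rewrite [ltLHS]mulrC.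
by rewrite ltr_pdivrMr// in ht; rewrite ltr_wpDl// [ltRHS]mulrC.
Qed.

End ExpDecay.

(** * The closed loop *)

Section Regressors.
Variables (R : realType) (n m : nat).
Implicit Types (a : 'I_n -> 'I_n -> R -> R) (th : 'cV[R]_(pdim n m)).

(** The index is in range because [j * m + r < (j + 1) * m <= m * n], so [inord] does not fall back
    to its default. *)
Lemma bixE (j : 'I_n) (r : 'I_m) : bix j r = (2 + j * m + r)%N :> nat.
Proof.
rewrite /bix inordK// /pdim -addnA add2n !ltnS.
have /leq_trans : (j * m + r < j.+1 * m)%N by rewrite mulSn addnC ltn_add2r.
by apply; rewrite mulnC leq_mul2l ltn_ord orbT.
Qed.

Lemma bix_inj (j j' : 'I_n) (r r' : 'I_m) : (bix j r == bix j' r') = (j == j') && (r == r').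
Proof.
apply/eqP/andP => [/(congr1 (@nat_of_ord _))|[/eqP-> /eqP->]//].
rewrite !bixE -!addnA => /addnI e.
have m0 : (0 < m)%N by apply: leq_ltn_trans (ltn_ord r).
have ej : j = j' :> nat.
  have := congr1 (divn^~ m) e; rewrite !divnMDl// !divn_small// ?addn0//.
by split; apply/eqP/val_inj => //=; move: e; rewrite ej => /addnI.
Qed.

Lemma bix_ge2 (j : 'I_n) (r : 'I_m) : (bix j r < 2)%N = false.
Proof. by rewrite bixE -addnA ltnNge leq_addr. Qed.

Lemma sum_bix (v : 'I_(pdim n m) -> R) j r :
  \sum_col (col == bix j r)%:R * v col = v (bix j r).
Proof.
rewrite (bigD1 (bix j r))//= eqxx mul1r big1 ?addr0// => c /negbTE ->.
by rewrite mul0r.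
Qed.

Lemma sum_Qblock c a i t r th :
  \sum_col Qblock c a i t r col * th col 0 = c * \sum_j Qsl a i j t * th (bix j r) 0.
Proof.
under eq_bigr => col _ do rewrite /Qblock -mulrA mulr_suml.
rewrite -mulr_sumr exchange_big/=; congr (_ * _); apply: eq_bigr => j _.
under eq_bigr => col _ do rewrite -mulrA.
by rewrite -mulr_sumr (sum_bix (fun col => th col 0)).
Qed.

Lemma Qblock_lt2 c a i t r (col : 'I_(pdim n m)) : (col < 2)%N -> Qblock c a i t r col = 0.
Proof.
move=> c2; rewrite /Qblock big1 ?mulr0// => j _.
by case: eqP => [e|]; rewrite ?mulr0//; rewrite e bix_ge2 in c2.
Qed.

Lemma Zmat_mulE (k : R -> R) a i t th r :
  (Zmat m k a i t *m th) r 0 = - (k t / 2) * \sum_j Qsl a i j t * th (bix j r) 0.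
Proof.
rewrite -sum_Qblock mxE; apply: eq_bigr => col _; rewrite mxE.
by case: ifP => // h; rewrite Qblock_lt2.
Qed.

Definition ix0 : 'I_(pdim n m) := Ordinal (isT : (0 < pdim n m)%N).
Definition ix1 : 'I_(pdim n m) := Ordinal (isT : (1 < pdim n m)%N).

Lemma Ymat_mulE (k : R -> R) a i (acc vel : 'cV[R]_m) t th r :
  (Ymat k a i acc vel t *m th) r 0 = acc r 0 * th ix0 0 + k t * vel r 0 * th ix1 0 +
    k t / 2 * \sum_j Qsl a i j t * th (bix j r) 0.
Proof.
rewrite -sum_Qblock mxE (bigD1 ix0)//= (bigD1 ix1)//= !mxE/=.
rewrite [in RHS](bigD1 ix0)//= [in RHS](bigD1 ix1)//= !Qblock_lt2// !mul0r !add0r -addrA.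
congr (_ + (_ + _)); apply: eq_bigr => col /andP[/negbTE c0 /negbTE c1].
rewrite mxE; have -> : (col == 0%N :> nat) = false by [].
by have -> : (col == 1%N :> nat) = false by [].
Qed.

Lemma theta_of_bix (b : 'I_n -> 'cV[R]_m) j r : theta_of b (bix j r) 0 = b j r 0.
Proof.
rewrite mxE bix_ge2 (bigD1 j)//= (bigD1 r)//= eqxx mul1r.
rewrite big1 ?addr0 => [|r' rr']; last first.
  by rewrite bix_inj eqxx/= eq_sym (negbTE rr') mul0r.
rewrite big1 ?addr0// => j' jj'; rewrite big1// => r' _.
by rewrite bix_inj eq_sym (negbTE jj') mul0r.
Qed.

Lemma theta_of_ix0 (b : 'I_n -> 'cV[R]_m) : theta_of b ix0 0 = 1.
Proof. by rewrite mxE. Qed.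

Lemma theta_of_ix1 (b : 'I_n -> 'cV[R]_m) : theta_of b ix1 0 = 1.
Proof. by rewrite mxE. Qed.

(** The signless Laplacian acts by edge sums, matching [z_ij + z_ji = b_i + b_j], where the
    positions cancel. *)
Lemma sum_Qsl a i t (v : 'I_n -> R) :
  \sum_j Qsl a i j t * v j = \sum_j a i j t * (v i + v j).
Proof.
pose S := \sum_l a i l t.
transitivity (\sum_j ((i == j)%:R * S * v j + a i j t * v j)).
  by apply: eq_bigr => j _; rewrite /Qsl mulrDl.
rewrite big_split/=.
have -> : \sum_j (i == j)%:R * S * v j = S * v i.
  rewrite (bigD1 i)//= eqxx mul1r [X in _ + X]big1 ?addr0// => j ji.
  by rewrite eq_sym (negbTE ji) !mul0r.
rewrite /S mulr_suml -big_split; apply: eq_bigr => j _ /=; ring.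
Qed.

End Regressors.

Lemma solves_acm (R : realType) p q (x f : R -> 'M[R]_(p, q)) : solves x f -> acm x f.
Proof.
move=> h i j t t0; have [h1 h2] := h t t0; split; first exact: h1.
by rewrite h2 !mxE.
Qed.

(** * Reduction of the closed loop to the error dynamics *)

Section ClosedLoopAnalysis.
Variables (R : realType) (n m : nat) (lam sig beta muF muIF : R) (k : R -> R) (kM : R).
Variables (a : 'I_n -> 'I_n -> R -> R) (b : 'I_n -> 'cV[R]_m).
Variables (q dq : 'I_n -> R -> 'cV[R]_m) (th : 'I_n -> R -> 'cV[R]_(pdim n m)).
Variables (YF : 'I_n -> R -> 'M[R]_(m, pdim n m)) (wF : 'I_n -> R -> 'cV[R]_m).
Variables (YIF : 'I_n -> R -> 'M[R]_(pdim n m)) (wIF : 'I_n -> R -> 'cV[R]_(pdim n m)).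
Hypotheses (lam0 : 0 < lam) (sig0 : 0 < sig) (beta0 : 0 < beta).
Hypothesis cl : closed_loop lam sig beta muF muIF k a b q dq th YF wF YIF wIF.

Let q_ac i : acm (q i) (dq i).
Proof. exact: solves_acm (cl i).1. Qed.
Let u i := uctl lam sig muF muIF k a b q dq th YF wF YIF wIF i.
Let ad i := adapt muF muIF a th YF wF YIF wIF i.
Let wx i := waux lam sig muF muIF k a b q dq th YF wF YIF wIF i.
Let dq_ac i : acm (dq i) (u i).
Proof. exact: solves_acm (cl i).2.1. Qed.
Let th_ac i : acm (th i) (ad i).
Proof. exact: solves_acm (cl i).2.2.1. Qed.
Let YIF_ac i : acm (YIF i) (fun t => (YF i t)^T *m YF i t).
Proof. by have [_ [_ [_ [_ [_ [[/solves_acm h _] _]]]]]] := cl i. Qed.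
Let YIF_0 i : YIF i 0 = 0.
Proof. by have [_ [_ [_ [_ [_ [[_ h] _]]]]]] := cl i. Qed.

Lemma zmeas_sum i t r :
  (\sum_j a i j t *: (zmeas b q i j t + zmeas b q j i t)) r 0 =
  \sum_j Qsl a i j t * b j r 0.
Proof.
rewrite (sum_Qsl _ _ _ (fun j => b j r 0)) summxE; apply: eq_bigr => j _.
by rewrite !mxE; ring.
Qed.

(** The control law solved for [w_i]: the first column of [Y_i] is [u_i] itself, and the remaining
    columns add back the velocity and bias feedback contained in [u_i]. *)
Lemma waux_regression i t : wx i t =
  Yreg lam sig muF muIF k a b q dq th YF wF YIF wIF i t *m theta_of b.
Proof.
apply/matrixP => r c; rewrite ord1 /Yreg Ymat_mulE theta_of_ix0 theta_of_ix1.
under eq_bigr => j _ do rewrite theta_of_bix.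
have -> : uctl lam sig muF muIF k a b q dq th YF wF YIF wIF i t r 0 =
  k t * (- dq i t r 0 - 2^-1 * \sum_j Qsl a i j t * b j r 0) + wx i t r 0.
  by rewrite -zmeas_sum /uctl -/(wx i) !mxE.
by field.
Qed.

(** Both filters start at zero and share the pole [- beta], so their difference solves
    [e' = - beta e]. *)
Lemma wF_regression i t : 0 <= t -> wF i t = YF i t *m theta_of b.
Proof.
move=> t0; apply/matrixP => r c; apply/eqP; rewrite -subr_eq0; apply/eqP.
have [_ [_ [_ [[/solves_acm YFac YF0] [[/solves_acm wFac wF0] _]]]]] := cl i.
have aE := acB (wFac r c) (acmM YFac (acm_cst (theta_of b)) r c).
apply: (linear_ode_zero beta0 aE) t0; first by rewrite wF0 YF0 mul0mx !mxE subrr.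
move=> w w0; rewrite mulmx0 addr0 mulmxDl -waux_regression -scalemxAl !mxE.
rewrite /wx; ring.
Qed.

Lemma wIF_regression i t : 0 <= t -> wIF i t = YIF i t *m theta_of b.
Proof.
move=> t0; apply/matrixP => r c.
have [_ [_ [_ [_ [_ [_ [/solves_acm wIFac wIF0]]]]]]] := cl i.
have h := acmM (YIF_ac i) (acm_cst (theta_of b)) r c.
have h2 : ac (fun t => (YIF i t *m theta_of b) r c) (fun t => ((YF i t)^T *m wF i t) r c).
  by apply: ac_eq h => // w w0; rewrite mulmx0 addr0 -mulmxA -wF_regression.
by apply: ac_unique (wIFac r c) h2 _ _ t0; rewrite wIF0 YIF_0 mul0mx.
Qed.

Let x i t := thtil b th i t.
Let dx i t := - ad i t.

Let x_ac i : acm (x i) (dx i).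
Proof.
move=> r c; have := acmB (acm_cst (theta_of b)) (th_ac i) r c.
by apply: ac_eq => t _ //; rewrite /dx add0r.
Qed.

Lemma thtil_rateE i t : 0 <= t -> dx i t =
  - (muF *: ((YF i t)^T *m (YF i t *m x i t)) + muIF *: (YIF i t *m x i t)
     + \sum_j a i j t *: (x i t - x j t)).
Proof.
move=> t0; rewrite /dx /ad /adapt wF_regression// wIF_regression// -!mulmxBr -/(x i t).
congr (- (_ + _)); rewrite -sumrN; apply: eq_bigr => j _.
rewrite -scalerN; congr (_ *: _); apply/matrixP => r c; rewrite /x /thtil !mxE; ring.
Qed.

Let s i t := sv lam b q dq th i t.
Let f i t := - (sig *: \sum_j a i j t *: (s i t - s j t)) + Zmat m k a i t *m x i t.

(** The [lam] term of [w_i] cancels the rate of [lam * (q_i + btil / 2)], the two terms [k * dq_i]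
    cancel, and the bias left by the measurements is [Z_i theta], so only [Z_i] times the error
    remains. *)
Lemma sv_ac i : acm (s i) (f i).
Proof.
move=> r c; rewrite (ord1 c).
have hb : ac (fun t => btil b th i i t r 0) (fun t => dbtil_ii muF muIF a th YF wF YIF wIF i t r 0).
  have := acB (ac_cst (b i r 0)) (th_ac i (bix i r) 0).
  by apply: ac_eq => t _; rewrite !mxE// add0r.
have h := acD (dq_ac i r 0) (acZ lam (acD (q_ac i r 0) (acZ 2^-1 hb))).
apply: ac_eq h => t t0; first by rewrite /s /sv !mxE.
have eD (A B : 'cV[R]_m) : (A + B) r 0 = A r 0 + B r 0 by rewrite mxE.
have eN (A : 'cV[R]_m) : (- A) r 0 = - A r 0 by rewrite mxE.
have eZ (l : R) (A : 'cV[R]_m) : (l *: A) r 0 = l * A r 0 by rewrite mxE.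
rewrite /f /x /thtil mulmxBr.
set S := \sum_j _.
have -> : u i t r 0 = k t * (- dq i t r 0 - 2^-1 * \sum_j Qsl a i j t * b j r 0) + wx i t r 0.
  by rewrite -zmeas_sum /u /uctl -/(wx i) !mxE.
have -> : wx i t r 0 = k t * dq i t r 0 - (Zmat m k a i t *m th i t) r 0
  - lam * (dq i t r 0 + 2^-1 * dbtil_ii muF muIF a th YF wF YIF wIF i t r 0) - sig * S r 0.
  by rewrite /wx /waux -/(s i t) -/S !(eD, eN, eZ).
have -> : (- (sig *: S) + (Zmat m k a i t *m theta_of b - Zmat m k a i t *m th i t)) r 0 =
  - (sig * S r 0) + ((Zmat m k a i t *m theta_of b) r 0 - (Zmat m k a i t *m th i t) r 0).
  by rewrite !(eD, eN, eZ).
rewrite [(Zmat m k a i t *m theta_of b) r 0]Zmat_mulE.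
under [X in - (k t / 2) * X]eq_bigr => j _ do rewrite theta_of_bix.
by field.
Qed.

(** * Convergence under joint connectivity and collective excitation *)

Variables (delta T aM gam Tbar t0 : R).
Hypotheses (muF0 : 0 < muF) (muIF0 : 0 < muIF).
Hypothesis k_bd : forall t : R, 0 <= t -> 0 < k t /\ k t <= kM.
Hypotheses (delta0 : 0 < delta) (T0 : 0 < T) (aM0 : 0 < aM).
Hypothesis a_meas : forall i j, measurable_fun [set t : R | 0 <= t] (a i j).
Hypothesis a_bd : forall i j (t : R), 0 <= t -> 0 <= a i j t /\ a i j t <= aM.
Hypothesis a_sym : forall i j (t : R), 0 <= t -> a i j t = a j i t.
Hypothesis a_conn : jointly_connected a delta T.
Hypotheses (gam0 : 0 < gam) (Tbar0 : 0 < Tbar) (t00 : 0 <= t0).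
Hypothesis exciting : psd_ge (mint (fun tau => \sum_(i < n) (YF i tau)^T *m YF i tau)
               t0 (t0 + Tbar)) (gam%:M).

Lemma excited_integral v : gam * nsq v <= \sum_i qf (YIF i (t0 + Tbar)) v.
Proof.
have le_t : t0 <= t0 + Tbar by rewrite lerDl ltW.
have := exciting v.
have -> : mint (fun tau => \sum_(i < n) (YF i tau)^T *m YF i tau) t0 (t0 + Tbar) =
    \sum_i (YIF i (t0 + Tbar) - YIF i t0).
  apply/matrixP => r c; rewrite mxE summxE.
  have h := ac_sum (index_enum 'I_n) xpredT (fun i => YIF_ac i r c).
  have := ac_diff h t00 le_t; rewrite -sumrB => e.
  under [RHS]eq_bigr => i _ do rewrite mxE [X in _ + X]mxE.
  by rewrite e; apply: eq_Rintegral => w _; rewrite summxE.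
rewrite -mulmxA -/(dotv v _) mulmxBl mul_scalar_mx dotvDr dotvNr dotvZr -/(nsq v) subr_ge0.
move=> h; apply: le_trans h _; rewrite mulmx_suml dotv_sumr; apply: ler_sum => i _.
rewrite mulmxBl dotvDr dotvNr -/(qf _ _) -/(qf _ _) gerDl oppr_le0.
exact: (gramian_ge0 YIF_ac YIF_0).
Qed.

Lemma thtil_decay i c : expdecay (fun t => x i t c 0).
Proof.
have ts0 : 0 <= t0 + Tbar by rewrite addr_ge0// ltW.
have [C [rho [C0 rho0 h]]] := cooperative_decay delta0 T0 aM0 muF0 muIF0 gam0 ts0 a_meas a_bd
  a_sym a_conn YIF_ac YIF_0 x_ac thtil_rateE excited_integral.
apply: (expdecay_sqrt C0 rho0) => t t0'; apply: le_trans (h t t0').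
apply: le_trans (sqr_entry_le_nsq _ _) _.
by rewrite (bigD1 i)//= lerDl sumr_ge0// => j _; exact: nsq_ge0.
Qed.

Lemma Qsl_bound i j t : 0 <= t -> `|Qsl a i j t| <= n%:R * aM + aM.
Proof.
move=> t0'; have [aij0 aijM] := a_bd i j t0'.
have S0 : 0 <= \sum_l a i l t by rewrite sumr_ge0// => l _; case: (a_bd i l t0').
have SM : \sum_l a i l t <= n%:R * aM.
  apply: (@le_trans _ _ (\sum_(l < n) aM)); last by rewrite sumr_const card_ord mulr_natl.
  by apply: ler_sum => l _; case: (a_bd i l t0').
rewrite /Qsl ger0_norm; last by rewrite addr_ge0// mulr_ge0.
by apply: lerD => //; case: eqP => _; rewrite ?mul1r// mul0r (le_trans S0).
Qed.

Lemma Zmat_thtil_decay i r : expdecay (fun t => (Zmat m k a i t *m x i t) r 0).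
Proof.
apply: (expdecay_eq (g := fun t => - (k t / 2) * \sum_j Qsl a i j t * x i t (bix j r) 0)).
  by move=> t _; rewrite Zmat_mulE.
apply: (expdecay_bounded_mul (M := kM)).
  move=> t t0'; have [k0 kk] := k_bd t0'.
  by rewrite normrN ger0_norm; lra.
apply: expdecay_sum => j; apply: (expdecay_bounded_mul (M := n%:R * aM + aM)).
  by move=> t; exact: Qsl_bound.
exact: thtil_decay.
Qed.

Lemma s_rateE i r t : f i t r 0 =
  - sig * \sum_j a i j t * (s i t r 0 - s j t r 0) + (Zmat m k a i t *m x i t) r 0.
Proof.
rewrite /f mxE; congr (_ + _); rewrite mxE mxE summxE mulNr; congr (- (_ * _)).
by apply: eq_bigr => j _; rewrite mxE; congr (_ * _); rewrite mxE [X in _ + X]mxE.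
Qed.

Lemma s_consensus r i j : expdecay (fun t => s i t r 0 - s j t r 0).
Proof.
have [c [rho [c0 rho0 hg]]] := expdecay_uniform (fun i => Zmat_thtil_decay i r).
have [C [r0 [C0 r00 h]]] := perturbed_consensus delta0 T0 aM0 sig0 rho0 a_meas a_bd a_sym a_conn
  (fun i => sv_ac i r 0) (fun i t _ => s_rateE i r t) hg.
by apply: (expdecay_sqrt C0 r00) => t t0'; exact: h.
Qed.

Lemma s_rate_decay i r : expdecay (fun t => f i t r 0).
Proof.
apply: (expdecay_eq (fun t _ => esym (s_rateE i r t))).
apply: expdecayD (Zmat_thtil_decay i r); apply: expdecayZ; apply: expdecay_sum => j.
apply: (expdecay_bounded_mul (M := aM)); last exact: s_consensus.
by move=> t t0'; have [h1 h2] := a_bd i j t0'; rewrite ger0_norm.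
Qed.

Lemma btil_decay i j r : expdecay (fun t => (b j - bpart (th i t) j) r 0).
Proof.
apply: expdecay_eq (thtil_decay i (bix j r)) => t _.
by rewrite /x /thtil mxE theta_of_bix !mxE.
Qed.

Lemma s_entry i r t : s i t r 0 =
  dq i t r 0 + lam * (q i t r 0 + 2^-1 * (b i - bpart (th i t) i) r 0).
Proof. by rewrite /s /sv /btil !mxE. Qed.

(* The signal s - lam q is a stable first-order filter of exponentially vanishing inputs. *)
Lemma filtered_decay i r : expdecay (fun t => s i t r 0 - lam * q i t r 0).
Proof.
apply: (expdecay_filter lam0 (acB (sv_ac i r 0) (acZ lam (q_ac i r 0)))).
have := expdecayD (s_rate_decay i r) (expdecayZ (lam ^+ 2 / 2) (btil_decay i i r)).
by apply: expdecay_eq => t _; rewrite s_entry; field.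
Qed.

(** [s - lam q] is the velocity plus [lam / 2] times the bias error. *)
Lemma velocity_decay i r : expdecay (fun t => dq i t r 0).
Proof.
have := expdecayB (filtered_decay i r) (expdecayZ (lam / 2) (btil_decay i i r)).
by apply: expdecay_eq => t _; rewrite s_entry; field.
Qed.

Lemma position_decay i j r : expdecay (fun t => (q i t - q j t) r 0).
Proof.
have := expdecayZ lam^-1 (expdecayB (s_consensus r i j)
  (expdecayB (filtered_decay i r) (filtered_decay j r))).
apply: expdecay_eq => t _.
have -> : (q i t - q j t) r 0 = q i t r 0 - q j t r 0 by rewrite !mxE.
by field; exact: lt0r_neq0.
Qed.

(** [s] is only shown to have an integrable rate, which bounds it; the parameter errors decay. *)
Lemma s_thtil_bounded : exists B : R, forall t, 0 <= t -> forall i,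
  `|s i t| <= B /\ `|x i t| <= B.
Proof.
have hs (ir : 'I_n * 'I_m) : exists B, forall t, 0 <= t -> `|s ir.1 t ir.2 0| <= B.
  exact: expdecay_primitive_bounded (sv_ac ir.1 ir.2 0) (s_rate_decay ir.1 ir.2).
have [cx [rho [cx0 rho0 hx]]] :=
  expdecay_uniform (fun ic : 'I_n * 'I_(pdim n m) => thtil_decay ic.1 ic.2).
have hB (ir : 'I_n * 'I_m) := cid (hs ir).
pose Bs := \sum_ir `|projT1 (hB ir)|.
have Bs0 : 0 <= Bs by exact: sumr_ge0.
exists (Bs + cx) => t t0' i; split; (apply: mx_norm_le => [|r c]; first exact: addr_ge0).
- rewrite (ord1 c); apply: le_trans (projT2 (hB (i, r)) t t0') _.
  apply: le_trans (ler_norm _) _; rewrite /Bs (bigD1 (i, r))//= -addrA lerDl.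
  by rewrite addr_ge0// sumr_ge0.
- rewrite (ord1 c); apply: le_trans (hx (i, r) t t0') _.
  apply: (@le_trans _ _ cx); last by rewrite lerDr.
  by rewrite ler_piMr// -expR0 ler_expR mulNr oppr_le0 mulr_ge0// ltW.
Qed.

(** The decay holds from time 0; restarting the exponential at [t0 + Tbar] only enlarges the bound.
    Summing the three norms gives common constants. *)
Lemma exponential_convergence : exists c rho : R, 0 < rho /\
  forall t, t0 + Tbar <= t -> forall i j : 'I_n,
  [/\ `|q i t - q j t| <= c * expR (- rho * (t - (t0 + Tbar))),
     `|dq i t| <= c * expR (- rho * (t - (t0 + Tbar))) &
     `|b i - bpart (th j t) i| <= c * expR (- rho * (t - (t0 + Tbar)))].
Proof.
have [c [rho [c0 rho0 h]]] := expdecay_uniform (fun ijr : 'I_n * 'I_n * 'I_m =>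
  expdecayD (expdecayD (expdecay_norm (position_decay ijr.1.1 ijr.1.2 ijr.2))
     (expdecay_norm (velocity_decay ijr.1.1 ijr.2)))
    (expdecay_norm (btil_decay ijr.1.2 ijr.1.1 ijr.2))).
exists c, rho; split => // t ht i j.
have t0' : 0 <= t by apply: le_trans ht; rewrite addr_ge0// ltW.
have e0 : 0 <= c * expR (- rho * (t - (t0 + Tbar))) by rewrite mulr_ge0// expR_ge0.
have le_e : c * expR (- rho * t) <= c * expR (- rho * (t - (t0 + Tbar))).
  by rewrite ler_wpM2l// ler_expR !mulNr lerN2 ler_pM2l// gerBl addr_ge0// ltW.
have hr r := le_trans (le_trans (ler_norm _) (h (i, j, r) t t0')) le_e.
split; apply: mx_norm_le => // r l; rewrite (ord1 l); apply: le_trans (hr r) => /=.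
- by rewrite -addrA lerDl addr_ge0.
- by rewrite addrAC lerDr addr_ge0.
- by rewrite lerDr addr_ge0.
Qed.

End ClosedLoopAnalysis.

Theorem theorem1 :
  forall (R : realType) (n m : nat) (lam sig beta muF : R),
  0 < lam -> 0 < sig -> 0 < beta -> 0 < muF ->
  (* positive, uniformly bounded gain k *)
  forall (k : R -> R) (kM : R),
  (forall t, 0 <= t -> 0 < k t /\ k t <= kM) ->
  (* (A1): undirected, bounded, jointly (delta,T)-connected graph *)
  forall (a : 'I_n -> 'I_n -> R -> R) (delta T aM : R),
  0 < delta -> 0 < T -> 0 < aM ->
  (forall i j, measurable_fun [set t : R | 0 <= t] (a i j)) ->
  (forall i j t, 0 <= t -> 0 <= a i j t /\ a i j t <= aM) ->
  (forall i t, 0 <= t -> a i i t = 0) ->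
  (forall i j t, 0 <= t -> a i j t = a j i t) ->
  jointly_connected a delta T ->
  (* constants of the collective initial excitation condition (A3) *)
  forall (Tbar gamma : R), 0 < Tbar -> 0 < gamma ->
  (* for sufficiently large mu_IF ... *)
  exists muIF0 : R, forall muIF : R, 0 < muIF -> muIF0 <= muIF ->
  (* ... for every bias vector and every closed-loop trajectory ... *)
  forall (b : 'I_n -> 'cV[R]_m)
         (q dq : 'I_n -> R -> 'cV[R]_m) (th : 'I_n -> R -> 'cV[R]_(pdim n m))
         (YF : 'I_n -> R -> 'M[R]_(m, pdim n m)) (wF : 'I_n -> R -> 'cV[R]_m)
         (YIF : 'I_n -> R -> 'M[R]_(pdim n m))
         (wIF : 'I_n -> R -> 'cV[R]_(pdim n m)),
  closed_loop lam sig beta muF muIF k a b q dq th YF wF YIF wIF ->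
  (* ... that is collectively initially exciting on [t0, t0 + Tbar] (A3) *)
  forall t0 : R, 0 <= t0 ->
  psd_ge (mint (fun tau => \sum_(i < n) (YF i tau)^T *m YF i tau)
               t0 (t0 + Tbar))
         (gamma%:M) ->
  (* bounded s and tilde theta *)
  (exists B : R, forall t, 0 <= t -> forall i : 'I_n,
      `|sv lam b q dq th i t| <= B /\ `|thtil b th i t| <= B) /\
  (* consensus, vanishing velocities, bias estimation *)
  (forall i j : 'I_n, (q i t - q j t) @[t --> +oo] --> (0 : 'cV[R]_m)) /\
  (forall i : 'I_n, dq i t @[t --> +oo] --> (0 : 'cV[R]_m)) /\
  (forall i l : 'I_n, (b i - bpart (th l t) i) @[t --> +oo] --> (0 : 'cV[R]_m)) /\
  (* exponential convergence after the excitation window *)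
  (exists c rho : R, 0 < rho /\
     forall t, t0 + Tbar <= t -> forall i j : 'I_n,
       [/\ `|q i t - q j t| <= c * expR (- rho * (t - (t0 + Tbar))),
           `|dq i t| <= c * expR (- rho * (t - (t0 + Tbar))) &
           `|b i - bpart (th j t) i| <= c * expR (- rho * (t - (t0 + Tbar)))]).
Proof.
move=> R n m lam sig beta muF lam0 sig0 beta0 muF0 k kM k_bd a delta T aM delta0 T0 aM0.
move=> a_meas a_bd _ a_sym a_conn Tbar gam Tbar0 gam0.
(* The threshold is 0: the size of a positive [muIF] only enters the constants and the rate. *)
exists 0 => muIF muIF0 _ b q dq th YF wF YIF wIF cl t0 t00 exciting.
split; first exact: (s_thtil_bounded sig0 beta0 cl muF0 muIF0 k_bd delta0 T0 aM0 a_meas a_bd a_sym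
  a_conn gam0 Tbar0 t00 exciting).
split.
  move=> i j; apply: expdecay_cvg0 => r c; rewrite (ord1 c).
  exact: (position_decay lam0 sig0 beta0 cl muF0 muIF0 k_bd delta0 T0 aM0 a_meas a_bd a_sym
    a_conn gam0 Tbar0 t00 exciting).
split.
  move=> i; apply: expdecay_cvg0 => r c; rewrite (ord1 c).
  exact: (velocity_decay lam0 sig0 beta0 cl muF0 muIF0 k_bd delta0 T0 aM0 a_meas a_bd a_sym
    a_conn gam0 Tbar0 t00 exciting).
split.
  move=> i l; apply: expdecay_cvg0 => r c; rewrite (ord1 c).
  exact: (btil_decay beta0 cl muF0 muIF0 delta0 T0 aM0 a_meas a_bd a_sym
    a_conn gam0 Tbar0 t00 exciting).
exact: (exponential_convergence lam0 sig0 beta0 cl muF0 muIF0 k_bd delta0 T0 aM0 a_meas a_bd a_sym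
  a_conn gam0 Tbar0 t00 exciting).
Qed.
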